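(* Let $f(x)=\mathbb{E}_{\xi\sim\mathcal{D}}[f_\xi(x)]$ on $\mathbb{R}^d$, let $f$ be twice differentiable, and suppose that Assumptions (A1) (unbiased, variance-bounded stochastic gradients and Hessians, with constants $\sigma_g,\sigma_H$), (A2) (lower boundedness) and (A3) (symmetric $(L_0,L_1)$-Lipschitz gradient with respect to $\|\cdot\|$, $L_1>0$), all stated in the context, hold. Let $K\ge 1$ be an integer, and let $\{x_k\}$ be the iterates generated, for $k=0,1,\ldots,K$, from initial points $x_0,m_0\in\mathbb{R}^d$ by $$x_{k+1}=x_k+\mathrm{lmo}_k(m_k),\qquad \mathrm{lmo}_k(m_k)\in\operatorname*{arg\,min}_{\|x\|\le\eta_k}\langle m_k,x\rangle,$$ $$\hat x_{k+1}=b_{k+1}x_{k+1}+(1-b_{k+1})x_k,\qquad b_{k+1}\sim\mathcal{U}(0,1),\qquad \xi_{k+1}\sim\mathcal{D},$$ $$m_{k+1}=(1-\alpha_k)\bigl(m_k+\nabla^2 f_{\xi_{k+1}}(\hat x_{k+1})(x_{k+1}-x_k)\bigr)+\alpha_k\nabla f_{\xi_{k+1}}(x_{k+1}),$$ with $$\alpha_k=\alpha=\frac{1}{(K+1)^{2/3}},\qquad \eta_k=\eta=\frac{\hat\eta}{(K+1)^{2/3}},\qquad \hat\eta=\frac{1}{80L_1}\left(\frac{\bar\rho}{\underline\rho}\right)^{-1}.$$ Then, with $e_0:=m_0-\nabla f(x_0)$, $$\min_{k\in\{0,1,\ldots,K\}}\mathbb{E}\bigl[\|\nabla f(x_k)\|_\star\bigr]\le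 \frac{2(f(x_0)-f_{\inf})}{\hat\eta(K+1)^{1/3}}+\frac{4\bigl(\mathbb{E}[\|e_0\|_\star]+\bar\rho\sigma_g\bigr)}{(K+1)^{1/3}}+\frac{\hat\eta L_0\exp(L_1\hat\eta)}{(K+1)^{2/3}}$$ $$\qquad+12\,\frac{\bar\rho}{\underline\rho}\,\frac{\hat\eta L_0}{(K+1)^{1/3}}\Bigl(\exp(L_1\hat\eta)+\sqrt{L_1\hat\eta}\,\exp(L_1\hat\eta)+2\Bigr)+8\,\frac{\bar\rho}{\underline\theta}\,\frac{\hat\eta\sigma_H}{(K+1)^{1/3}}.$$
   Context: $\|\cdot\|$ is an arbitrary norm on $\mathbb{R}^d$, $\|\cdot\|_\star$ its dual norm ($\|u\|_\star=\max_{\|v\|\le 1}\langle u,v\rangle$), $\|\cdot\|_2$ the Euclidean norm and $\langle\cdot,\cdot\rangle$ the standard inner product. The positive constants $\underline\rho,\bar\rho,\underline\theta,\bar\theta$ satisfy, for all $x\in\mathbb{R}^d$, $\underline\rho\|x\|_2\le\|x\|_\star\le\bar\rho\|x\|_2$ and $\underline\theta\|x\|_2\le\|x\|\le\bar\theta\|x\|_2$. $\xi$ is a random vector with distribution $\mathcal{D}$; each $f_\xi:\mathbb{R}^d\to\mathbb{R}$ is differentiable and possibly nonconvex; $\nabla f_\xi(x)$ and $\nabla^2 f_\xi(x)$ are the stochastic gradient and stochastic Hessian. (A1) For all $x,w\in\mathbb{R}^d$: $\mathbb{E}_\xi[\nabla f_\xi(x)]=\nabla f(x)$, $\mathbb{E}_\xi[\|\nabla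 f_\xi(x)-\nabla f(x)\|_2^2]\le\sigma_g^2$, $\mathbb{E}_\xi[\nabla^2 f_\xi(x)]=\nabla^2 f(x)$, and $\mathbb{E}_\xi[\|(\nabla^2 f_\xi(x)-\nabla^2 f(x))w\|_2^2]\le\sigma_H^2\|w\|_2^2$. (A2) $f_{\inf}:=\inf_{x\in\mathbb{R}^d}f(x)>-\infty$. (A3) $f$ is differentiable and, for all $x,y\in\mathbb{R}^d$, $\|\nabla f(x)-\nabla f(y)\|_\star\le\bigl(L_0+L_1\sup_{\theta\in[0,1]}\|\nabla f(\theta x+(1-\theta)y)\|_\star\bigr)\|x-y\|$. The samples $\xi_1,\xi_2,\ldots$ are independent with law $\mathcal{D}$, the $b_1,b_2,\ldots$ are independent and uniform on $(0,1)$ and independent of the $\xi$'s; if $m_0$ is random it is independent of all of these. $\mathbb{E}$ is expectation over all randomness. When the linear minimization problem has several minimizers, $\mathrm{lmo}_k$ is any (measurable) selection. *)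

(* Defs.v *)
From HB Require Import structures.
From mathcomp Require Import all_boot all_order all_algebra finmap.
From mathcomp Require Import all_classical all_reals all_analysis.

Set Implicit Arguments.
Unset Strict Implicit.
Unset Printing Implicit Defensive.

Import Order.TTheory GRing.Theory Num.Theory.
Import numFieldNormedType.Exports.

Local Open Scope classical_set_scope.
Local Open Scope ring_scope.

Section norms.
Context {R : realType} {d : nat}.
Implicit Types (u v x : 'rV[R]_d) (N : 'rV[R]_d -> R).

Definition dot u v : R := \sum_(i < d) u ord0 i * v ord0 i.

(* The norm that the library puts on 'rV[R]_d is the sup norm. *)
Definition norm2 u : R := Num.sqrt (dot u u).

Record is_norm N : Prop := IsNorm {
  is_norm_definite : forall u, N u = 0 -> u = 0 ;
  is_norm_homogeneous : forall (a : R) u, N (a *: u) = `|a| * N u ;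
  is_norm_triangle : forall u v, N (u + v) <= N u + N v }.

(* For a norm N the supremum is over a nonempty bounded set, and attained. *)
Definition dual_norm N u : R := sup [set dot u v | v in [set v | N v <= 1]].

Definition is_lmo N (eta : R) m x : Prop :=
  N x <= eta /\ forall y, N y <= eta -> dot m x <= dot m y.

End norms.

Section calculus.
Context {R : realType} {d : nat}.

Definition grad (f : 'rV[R]_d -> R) (x : 'rV[R]_d) : 'rV[R]_d :=
  \row_i 'D_(delta_mx ord0 i) f x.

(* Acts on row vectors: the vector written as hess f x times w in column
   notation is w *m hess f x. *)
Definition hess (f : 'rV[R]_d -> R) (x : 'rV[R]_d) : 'M[R]_d :=
  'J (grad f) x.

Definition twice_differentiable (f : 'rV[R]_d -> R) : Prop :=
  (forall x, differentiable f x) /\ (forall x, differentiable (grad f) x).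

(* If grad f is continuous the supremum is over a bounded set. *)
Definition symmetric_L0L1_lipschitz (N : 'rV[R]_d -> R) (L0 L1 : R)
    (f : 'rV[R]_d -> R) : Prop :=
  forall x y : 'rV[R]_d,
    dual_norm N (grad f x - grad f y) <=
    (L0 + L1 * sup [set dual_norm N (grad f (t *: x + (1 - t) *: y))
                   | t in `[0%R, 1%R]]) * N (x - y).

End calculus.

(* The library gives matrices a topology but no measurable structure. *)
Definition borel_rV (R : realType) (d : nat) : measurableType _ :=
  g_sigma_algebraType (@open 'rV[R]_d).

Section probability.
Context {dT : measure_display} {T : measurableType dT} {R : realType}.
Variable P : probability T R.

(* 'E_P[X] has a value even when X is not integrable. *)
Definition has_mean (X : T -> R) (r : R) : Prop :=
  P.-integrable setT (EFin \o X) /\ ('E_P[X] = r%:E)%E.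

(* Restricted to measurable sets: measures are total set functions. *)
Definition has_law {dU : measure_display} {U : measurableType dU}
    (X : {RV P >-> U}) (mu : set U -> \bar R) : Prop :=
  forall A : set U, measurable A -> distribution P X A = mu A.

(* S i is meant to be a sub-sigma-algebra of T for every i. *)
Definition mutually_independent {I : choiceType} (S : I -> set (set T)) : Prop :=
  forall (J : {fset I}) (A : I -> set T), (forall i, i \in J -> S i (A i)) ->
    P (\bigcap_(i in [set` J]) A i) = (\prod_(i <- J) P (A i))%E.

End probability.

Section stochastic_oracle.
Context {R : realType} {d : nat} {dZ : measure_display} {Z : measurableType dZ}.
Variables (D : probability Z R) (F : Z -> 'rV[R]_d -> R) (f : 'rV[R]_d -> R).

Record stochastic_gradient_hessian (sigma_g sigma_H : R) : Prop := {
  grad_unbiased : forall (x : 'rV[R]_d) (i : 'I_d),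
    has_mean D (fun z => grad (F z) x ord0 i) (grad f x ord0 i) ;
  grad_variance : forall x : 'rV[R]_d,
    ('E_D[fun z => (norm2 (grad (F z) x - grad f x) ^+ 2)%R]
      <= (sigma_g ^+ 2)%:E)%E ;
  hess_unbiased : forall (x : 'rV[R]_d) (i j : 'I_d),
    has_mean D (fun z => hess (F z) x i j) (hess f x i j) ;
  hess_variance : forall x w : 'rV[R]_d,
    ('E_D[fun z => (norm2 (w *m (hess (F z) x - hess f x)) ^+ 2)%R]
      <= (sigma_H ^+ 2 * norm2 w ^+ 2)%:E)%E }.

End stochastic_oracle.

Section randomness.
Context {R : realType} {d : nat} {dT dZ : measure_display}
  {T : measurableType dT} {Z : measurableType dZ}.

Definition source_sigma_algebra (P : probability T R) (m0 : T -> 'rV[R]_d)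
    (xi : nat -> {RV P >-> Z}) (b : nat -> {RV P >-> R})
    (i : option (nat + nat)) : set (set T) :=
  match i with
  | None => preimage_set_system setT (m0 : T -> borel_rV R d) measurable
  | Some (inl k) => preimage_set_system setT (xi k) measurable
  | Some (inr k) => preimage_set_system setT (b k) measurable
  end.

End randomness.

(* Main.v *)
Require Import Defs.
From HB Require Import structures.
From mathcomp Require Import all_boot all_order all_algebra finmap ring lra.
From mathcomp Require Import all_classical all_reals all_analysis.
From mathcomp Require Import measurable_realfun.

Set Implicit Arguments.
Unset Strict Implicit.
Unset Printing Implicit Defensive.

Import Order.TTheory GRing.Theory Num.Theory.
Import numFieldNormedType.Exports.

Local Open Scope classical_set_scope.
Local Open Scope ring_scope.

(** The error [e_k = m_k - grad f x_k] satisfies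
      [e_(k+1) = (1 - alpha) (e_k + Z_k + W_k) + alpha V_k],
    where [Z_k = grad f x_k - grad f x_(k+1) + hess f xhat_(k+1) (x_(k+1) - x_k)]
    is centred over the uniform variable (fundamental theorem of calculus along
    the step) and the sampling errors [W_k] of the Hessian and [V_k] of the
    gradient are centred over the fresh sample.  Along a step of length [eta]
    with [L1 eta <= 1/80] the quantity [L0 + L1 |grad f|] varies at most by the
    factor 80/79, so [|Z_k|] is of order [(L0 + L1 |grad f x_k|) eta].  Cutting
    on the event [L1 |grad f x_k| <= L0], which belongs to the past and hence
    keeps the conditional mean zero, leaves a martingale whose second moment is
    bounded by constants, and a remainder of order [L1 eta |grad f x_k|] to
    which the triangle inequality applies.  Summing the remainder over [k] costs
    [L1 eta / alpha = L1 eta_hat <= 1/80] times the sum of the gradient norms;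
    inserted into the summed descent inequality, it is absorbed on the left. *)

(** * Dual norms *)

(** The cut is forced by a mismatch of moments. The second moment of the whole bias would bring in
    the mean of [|grad f x_k|^2], whereas the descent inequality offers only first powers to absorb
    it. The triangle inequality alone, on the other hand, sums the biases without cancellation, and
    their [L0] part then contributes [L0 eta / alpha = L0 eta_hat], which does not decrease with
    [K]. After the cut the [L0] part enjoys square-root cancellation and costs
    [L0 eta / sqrt alpha], and the other part is proportional to the quantity to be bounded.
    Cancellation is available only in the Euclidean norm, where the cross terms are inner products
    that can be integrated. The equivalence constants are therefore paid on the martingale alone;
    the remainder stays in the dual norm throughout. Hessians exist everywhere but are not assumed
    continuous. This is why the fundamental theorem of calculus is shown for a merely bounded
    derivative, and why Hessians are handled as limits of difference quotients of gradients. *)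

Section dot_theory.
Context {R : realType} {d : nat}.
Implicit Types (u v w : 'rV[R]_d) (a : R).

Lemma dotC u v : dot u v = dot v u.
Proof. by apply: eq_bigr => i _; rewrite mulrC. Qed.

Lemma dotDl u v w : dot (u + v) w = dot u w + dot v w.
Proof. by rewrite -big_split; apply: eq_bigr => i _; rewrite !mxE mulrDl. Qed.

Lemma dotZl a u v : dot (a *: u) v = a * dot u v.
Proof. by rewrite mulr_sumr; apply: eq_bigr => i _; rewrite !mxE mulrA. Qed.

Lemma dotDr u v w : dot w (u + v) = dot w u + dot w v.
Proof. by rewrite dotC dotDl !(dotC w). Qed.

Lemma dotZr a u v : dot v (a *: u) = a * dot v u.
Proof. by rewrite dotC dotZl dotC. Qed.

Lemma dotNl u v : dot (- u) v = - dot u v.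
Proof. by rewrite -scaleN1r dotZl mulN1r. Qed.

Lemma dotNr u v : dot u (- v) = - dot u v.
Proof. by rewrite dotC dotNl dotC. Qed.

Lemma dot_ge0 u : 0 <= dot u u.
Proof. by apply: sumr_ge0 => i _; rewrite -expr2 sqr_ge0. Qed.

Lemma norm2_ge0 u : 0 <= norm2 u. Proof. exact: sqrtr_ge0. Qed.

Lemma sqr_norm2 u : norm2 u ^+ 2 = dot u u.
Proof. by rewrite sqr_sqrtr ?dot_ge0. Qed.

Lemma norm2Z a u : norm2 (a *: u) = `|a| * norm2 u.
Proof. by rewrite /norm2 dotZl dotZr mulrA -expr2 sqrtrM ?sqr_ge0 ?sqrtr_sqr. Qed.

Lemma norm2N u : norm2 (- u) = norm2 u.
Proof. by rewrite -scaleN1r norm2Z normrN1 mul1r. Qed.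

Lemma norm2_coord u i : `|u ord0 i| <= norm2 u.
Proof.
rewrite -ler_sqr ?nnegrE ?norm2_ge0 ?normr_ge0// sqr_norm2 /dot (bigD1 i)//=.
rewrite -[X in X + _]expr2 real_normK ?num_real// lerDl.
by apply: sumr_ge0 => j _; rewrite -expr2 sqr_ge0.
Qed.

Lemma rV_coord_le_norm u i : `|u ord0 i| <= `|u|.
Proof.
rewrite [leRHS]mx_normrE.
exact: (le_bigmax _ (fun j => `|u j.1 j.2|) (ord0, i)).
Qed.

Lemma norm2_mx_norm u : norm2 u <= Num.sqrt d%:R * `|u|.
Proof.
rewrite -ler_sqr ?nnegrE ?norm2_ge0 ?mulr_ge0 ?sqrtr_ge0//.
rewrite sqr_norm2 exprMn sqr_sqrtr ?ler0n// /dot mulr_natl.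
rewrite -[X in _ *+ X]card_ord -sumr_const; apply: ler_sum => i _.
rewrite -[leLHS]expr2 -[leLHS]real_normK ?num_real// ler_sqr ?nnegrE//.
exact: rV_coord_le_norm.
Qed.

Lemma dot_le_sqr u v : 2 * dot u v <= norm2 u ^+ 2 + norm2 v ^+ 2.
Proof.
have := dot_ge0 (u - v).
rewrite !sqr_norm2 !(dotDl, dotDr, dotNl, dotNr) (dotC v u); lra.
Qed.

Lemma dot_abs_le_sqr u v : `|dot u v| <= norm2 u ^+ 2 + norm2 v ^+ 2.
Proof.
have h1 := dot_le_sqr u v; have h2 := dot_le_sqr (- u) v.
rewrite dotNl norm2N in h2.
have := sqr_ge0 (norm2 u); have := sqr_ge0 (norm2 v).
by rewrite ler_norml; lra.
Qed.

(** Rescaling to [norm2 v *: u] and [norm2 u *: v] makes the two norms equal, and [dot_le_sqr] then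
    gives the product of the norms; a vanishing norm forces a zero vector. *)
Lemma cauchy_schwarz_dot u v : dot u v <= norm2 u * norm2 v.
Proof.
have [a0 b0] := (norm2_ge0 u, norm2_ge0 v).
have h := dot_le_sqr (norm2 v *: u) (norm2 u *: v).
rewrite dotZl dotZr !norm2Z !ger0_norm// in h.
have [/eqP|ab] := eqVneq (norm2 u * norm2 v) 0; last first.
  have {}ab : 0 < norm2 u * norm2 v by rewrite lt0r ab mulr_ge0.
  rewrite -(ler_pM2l ab); nra.
have z w : norm2 w = 0 -> w = 0.
  move=> w0; apply/rowP => i; apply/eqP; rewrite mxE -normr_le0 -w0.
  exact: norm2_coord.
have z0 w : dot 0 w = 0 by rewrite -(scale0r (0 : 'rV_d)) dotZl mul0r.
by rewrite mulf_eq0 => /orP[]/eqP/z ->; rewrite ?(dotC u) z0 mulr_ge0// norm2_ge0.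
Qed.

Lemma sqr_norm2D u v :
  norm2 (u + v) ^+ 2 = norm2 u ^+ 2 + 2 * dot u v + norm2 v ^+ 2.
Proof. rewrite !sqr_norm2 !(dotDl, dotDr) (dotC v u); ring. Qed.

Lemma sqr_norm2D3_le u v w :
  norm2 (u + v + w) ^+ 2 <= 3 * (norm2 u ^+ 2 + norm2 v ^+ 2 + norm2 w ^+ 2).
Proof.
have h1 := dot_le_sqr u v; have h2 := dot_le_sqr u w.
have h3 := dot_le_sqr v w.
rewrite 2!sqr_norm2D dotDl; lra.
Qed.

End dot_theory.

Section norm_theory.
Context {R : realType} {d : nat} (N : 'rV[R]_d -> R) (N_norm : is_norm N).
Implicit Types (u v w : 'rV[R]_d) (a : R).

Lemma is_norm0 : N 0 = 0.
Proof. by rewrite -(scale0r (0 : 'rV_d)) is_norm_homogeneous// normr0 mul0r. Qed.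

Lemma is_normN u : N (- u) = N u.
Proof. by rewrite -scaleN1r is_norm_homogeneous// normrN1 mul1r. Qed.

Lemma is_norm_ge0 u : 0 <= N u.
Proof.
have := is_norm_triangle N_norm u (- u).
by rewrite subrr is_norm0 is_normN; lra.
Qed.

Context (theta_lo : R) (theta_lo_gt0 : 0 < theta_lo).
Context (N_lb : forall u, theta_lo * norm2 u <= N u).

Let dual_has_sup u : has_sup [set dot u v | v in [set v | N v <= 1]].
Proof.
split; first by exists (dot u 0); exists 0 => //=; rewrite is_norm0.
exists (norm2 u / theta_lo) => _ [v /= Nv <-].
rewrite (le_trans (cauchy_schwarz_dot u v))// ler_wpM2l ?norm2_ge0//.
by rewrite -(ler_pM2l theta_lo_gt0) mulfV ?gt_eqF// (le_trans (N_lb v)).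
Qed.

Lemma dual_norm_ub u v : N v <= 1 -> dot u v <= dual_norm N u.
Proof. by move=> Nv; apply: ub_le_sup; [exact: (dual_has_sup u).2|exists v]. Qed.

Lemma dual_norm_le u a :
  (forall v, N v <= 1 -> dot u v <= a) -> dual_norm N u <= a.
Proof.
move=> h; apply: ge_sup; first exact: (dual_has_sup u).1.
by move=> _ [v /= Nv <-]; exact: h.
Qed.

Lemma dual_norm_ge0 u : 0 <= dual_norm N u.
Proof.
have := @dual_norm_ub u 0; rewrite is_norm0 => /(_ ler01).
by rewrite -(scale0r (0 : 'rV_d)) dotZr mul0r.
Qed.

Lemma dot_le_dual u v : dot u v <= dual_norm N u * N v.
Proof.
have [/eqP|Nv] := eqVneq (N v) 0.
  move=> /eqP/(is_norm_definite N_norm) ->.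
  by rewrite -(scale0r (0 : 'rV_d)) dotZr is_norm_homogeneous// normr0 !mul0r mulr0.
have {}Nv : 0 < N v by rewrite lt0r Nv is_norm_ge0.
rewrite -ler_pdivrMr// mulrC -dotZr dual_norm_ub//.
by rewrite is_norm_homogeneous// ger0_norm ?invr_ge0 ?is_norm_ge0// mulVf// gt_eqF.
Qed.

Lemma dual_normD u v : dual_norm N (u + v) <= dual_norm N u + dual_norm N v.
Proof. by apply: dual_norm_le => w Nw; rewrite dotDl lerD// dual_norm_ub. Qed.

Lemma dual_normZ_le a u : dual_norm N (a *: u) <= `|a| * dual_norm N u.
Proof.
apply: dual_norm_le => v Nv; rewrite dotZl -dotZr mulrC.
rewrite (le_trans (dot_le_dual _ _))// ler_wpM2l ?dual_norm_ge0//.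
by rewrite is_norm_homogeneous// ler_piMr.
Qed.

Lemma dual_normN u : dual_norm N (- u) = dual_norm N u.
Proof.
have h w : dual_norm N (- w) <= dual_norm N w.
  by rewrite -scaleN1r (le_trans (dual_normZ_le _ _))// normrN1 mul1r.
by apply/eqP; rewrite eq_le h -{1}(opprK u) h.
Qed.

(** The competitors are [- eta *: w] with [w] in the unit ball; passing to the supremum over [w]
    divides by [eta], whence the separate case [eta = 0]. *)
Lemma dual_norm_lmo eta u v : 0 <= eta -> is_lmo N eta u v ->
  dot u v <= - (eta * dual_norm N u).
Proof.
move=> eta0 [_ vP]; have [->|] := eqVneq eta 0.
  rewrite mul0r oppr0 (le_trans (vP 0 _)) ?is_norm0//.
  by rewrite -(scale0r (0 : 'rV_d)) dotZr mul0r.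
move=> eta_neq0; have {}eta0 : 0 < eta by rewrite lt0r eta_neq0.
rewrite lerNr -ler_pdivlMl//; apply: dual_norm_le => w Nw.
rewrite ler_pdivlMl// lerNr -mulNr -dotZr vP// is_norm_homogeneous//.
by rewrite normrN gtr0_norm// ler_piMr// ltW.
Qed.

End norm_theory.

(** * Borel measurability of vector-valued maps *)

Lemma measurable_borel_rV {R : realType} {d : nat} (U : set 'rV[R]_d) :
  open U -> measurable (U : set (borel_rV R d)).
Proof. by move=> oU; exact: sub_gen_smallest. Qed.

Lemma continuous_measurable_rV {R : realType} {d : nat} (g : 'rV[R]_d -> R) :
  continuous g -> measurable_fun setT (g : borel_rV R d -> R).
Proof.
move=> gc; apply: (measurability _ (RGenOpens.measurableE R)) => _ [_ [A [oA ->] <-]].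
rewrite setTI.
apply: measurable_borel_rV; move/continuousP: gc; exact.
Qed.

Section borel_rV_coord.
Context {dT : measure_display} {T : measurableType dT} {R : realType} {d : nat}.
Implicit Types X : T -> 'rV[R]_d.

Lemma measurable_rV_coord X i :
  measurable_fun setT (X : T -> borel_rV R d) ->
  measurable_fun setT (fun t => X t ord0 i).
Proof.
move=> mX; pose c (u : borel_rV R d) : R := (u : 'rV[R]_d) ord0 i.
have mc : measurable_fun setT c.
  by apply: continuous_measurable_rV; exact: coord_continuous.
exact: measurableT_comp mc mX.
Qed.

(** An open set is a countable union of cubes with rational centre and radius [n.+1%:R^-1], and each
    cube is a finite intersection of coordinate conditions. *)
Lemma measurable_rV X : (forall i, measurable_fun setT (fun t => X t ord0 i)) ->
  measurable_fun setT (X : T -> borel_rV R d).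
Proof.
move=> mX; apply: (@measurability _ _ T (borel_rV R d) setT X (@open 'rV[R]_d) erefl) => _ [U oU <-].
pose box (a : 'rV[rat]_d) (n : nat) : set 'rV[R]_d :=
  [set x | forall i, `|x ord0 i - ratr (a ord0 i)| < n.+1%:R^-1].
have -> : setT `&` X @^-1` U =
    \bigcup_(p in [set p : 'rV[rat]_d * nat | box p.1 p.2 `<=` U])
      (X @^-1` box p.1 p.2).
  rewrite setTI; apply/seteqP; split => t /=; last by case=> p /= h; exact: h.
  move: oU; rewrite openE => /[apply] /nbhs_ballP[e /= e0 eU].
  (* Both points lie within [n.+1%:R^-1] of the rational centre, so twice this radius has to stay
     below [e]. *)
  pose n := Num.truncn (2 / e).
  have nE : 2 * n.+1%:R^-1 < e.
    by rewrite ltr_pdivrMr ?ltr0n// mulrC -ltr_pdivrMr// truncnS_gt.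
  have h (r : R) i : 0 < r -> exists q, `|X t ord0 i - ratr q| < r.
    move=> r0; have [|q] := @rat_in_itvoo R (X t ord0 i - r) (X t ord0 i + r).
      by rewrite ltrD2l gtrN.
    by rewrite in_itv/= => /andP[h1 h2]; exists q; rewrite ltr_norml; lra.
  have n0 : 0 < n.+1%:R^-1 :> R by rewrite invr_gt0.
  have [q qP] := choice (fun i => h _ i n0).
  exists (\row_i q i, n) => /=; last by move=> i; rewrite mxE.
  move=> y /= hy; apply: eU; rewrite -ball_normE /ball_ /=.
  rewrite (le_lt_trans _ nE)// [leLHS]mx_normrE; apply/bigmax_leP; split.
    by rewrite mulr_ge0// invr_ge0.
  move=> [k i] _ /=; rewrite ord1 !mxE.
  have := qP i; have := hy i; rewrite mxE !ltr_norml ler_norml.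
  by move: n.+1%:R^-1 => r; lra.
rewrite bigcup_mkcond; apply: countable_bigcupT_measurable => // p.
case: ifP => // _; rewrite (_ : X @^-1` _ = \bigcap_(i in [set: 'I_d])
    [set t | `|X t ord0 i - ratr (p.1 ord0 i)| < p.2.+1%:R^-1]); last first.
  by apply/seteqP; split => t /= h i => [_|]; exact: h.
apply: fin_bigcap_measurable => // i _.
rewrite -[X in measurable X]setTI.
apply: measurable_fun_ltr => //.
apply: measurableT_comp => //; apply: measurable_funB => //; exact: mX.
Qed.

End borel_rV_coord.

Lemma continuous_measurable_rV_rV {R : realType} {d : nat}
    (g : 'rV[R]_d -> 'rV[R]_d) : continuous g ->
  measurable_fun setT (g : borel_rV R d -> borel_rV R d).
Proof.
move=> gc; apply: measurable_rV => i.
apply: (continuous_measurable_rV (g := fun x => g x ord0 i)) => x.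
exact: (continuous_comp (gc x) (@coord_continuous _ _ _ ord0 i (g x))).
Qed.

Section caratheodory.
Context {dZ : measure_display} {Z : measurableType dZ} {R : realType} {d : nat}.
Implicit Types phi : Z -> 'rV[R]_d -> R.

(** The lattice of mesh [1 / n.+1]: [grid n x] labels the cell of [x], and [grid_pt] returns the
    corner of that cell. Labels are integer vectors so that they form a countable type. *)
Let grid (n : nat) (x : 'rV[R]_d) : 'rV[int]_d :=
  \row_i Num.floor (n.+1%:R * x ord0 i).
Let grid_pt (n : nat) (q : 'rV[int]_d) : 'rV[R]_d :=
  \row_i ((q ord0 i)%:~R / n.+1%:R).

Let grid_cvg x : grid_pt n (grid n x) @[n --> \oo] --> x.
Proof.
apply/cvgrPdist_le => e e0; near=> n.
rewrite [leLHS]mx_normrE; apply/bigmax_leP; split; first exact: ltW.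
move=> [k i] _ /=; rewrite ord1 !mxE.
have n0 : 0 < n.+1%:R :> R by rewrite ltr0n.
have -> : x ord0 i - (Num.floor (n.+1%:R * x ord0 i))%:~R / n.+1%:R =
    (n.+1%:R * x ord0 i - (Num.floor (n.+1%:R * x ord0 i))%:~R) / n.+1%:R.
  by field; rewrite gt_eqF.
rewrite normrM normfV (gtr0_norm n0) ler_pdivrMr//.
rewrite (@le_trans _ _ 1)//; last first.
  rewrite -ler_pdivrMr// mul1r; apply/ltW; near: n.
  exact: (near_infty_natSinv_lt (PosNum e0)).
have := floor_le (n.+1%:R * x ord0 i); have := floorD1_gt (n.+1%:R * x ord0 i).
rewrite intrD ler_norml; lra.
Unshelve. all: by end_near. Qed.

(** Rounding [x] to the lattice gives maps that converge pointwise by continuity; each is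
    measurable, since on any of the countably many cells it is [phi] at a fixed point. *)
Lemma measurable_caratheodory phi :
  (forall x, measurable_fun setT (phi ^~ x)) -> (forall z, continuous (phi z)) ->
  measurable_fun setT (fun p : Z * borel_rV R d => phi p.1 p.2).
Proof.
move=> mphi cphi.
apply: (@measurable_fun_cvg _ (Z * borel_rV R d)%type R setT
  (fun n p => phi p.1 (grid_pt n (grid n p.2)))) => //;
  last first.
  by move=> [z x] _ /=; apply: (cvg_comp _ _ (@grid_cvg x)); exact: cphi.
move=> n _ B mB; rewrite setTI.
rewrite (_ : _ @^-1` B = \bigcup_(q in [set: 'rV[int]_d])
    ((phi ^~ (grid_pt n q) @^-1` B) `*` [set x | grid n x = q])); last first.
  apply/seteqP; split => [[z x] /= h|[z x] /= [q _ /= [h1 h2]]].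
    by exists (grid n x).
  by rewrite h2.
apply: countable_bigcupT_measurable => // q.
apply: measurableX; first by rewrite -[X in measurable X]setTI; exact: mphi.
rewrite (_ : [set x | _] = \bigcap_(i in [set: 'I_d]) [set x : borel_rV R d |
    (q ord0 i)%:~R <= n.+1%:R * x ord0 i < (q ord0 i + 1)%:~R]); last first.
  apply/seteqP; split => x /= h.
    by move=> i _ /=; rewrite -h mxE floor_itv.
  by apply/rowP => i; rewrite mxE; apply: floor_def; exact: h.
apply: fin_bigcap_measurable => // i _.
have mi : measurable_fun setT (fun x : borel_rV R d => n.+1%:R * x ord0 i).
  by apply: measurable_funM => //; by apply: continuous_measurable_rV; exact: coord_continuous.
rewrite -[X in measurable X]setTI.
apply: (measurable_and (f := fun x : borel_rV R d => _ <= _)) => //.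
- exact: measurable_fun_ler.
- exact: measurable_fun_ltr.
Qed.

End caratheodory.

(** * Independence and Fubini *)

Section independence.
Context {dT : measure_display} {T : measurableType dT} {R : realType}.
Context (P : probability T R) {I : choiceType} (S : I -> set (set T)).
Hypothesis S_meas : forall i, S i `<=` measurable.
Hypothesis S_setT : forall i, S i setT.
Hypothesis S_setI : forall i, setI_closed (S i).

(* pi-lambda: finite intersections of events from the sources in J form a
   pi-system generating the left-hand sigma-algebra. *)
Lemma mutually_independent_generated (J : set I) (j : I) (A B : set T) :
  mutually_independent P S -> ~ J j ->
  <<s \bigcup_(i in J) S i >> A -> S j B -> P (A `&` B) = (P A * P B)%E.
Proof.
move=> indep Jj sA SB.
pose G : set (set T) := [set C | exists (F : {fset I}) (E : I -> set T),
  [/\ [set` F] `<=` J, forall i, S i (E i) & C = \bigcap_(i in [set` F]) E i]].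
have SG : \bigcup_(i in J) S i `<=` G.
  move=> C [i Ji SiC].
  exists [fset i]%fset, (fun k => if k == i then C else setT); split.
  - by move=> k /=; rewrite inE => /eqP ->.
  - by move=> k; case: eqVneq => [->|].
  - apply/seteqP; split => t /=.
      by move=> Ct k; rewrite /= inE => /eqP ->; rewrite eqxx.
    by move=> /(_ i); rewrite /= inE eqxx; exact.
have Gm : G `<=` measurable.
  move=> _ [F [E [_ SE ->]]]; apply: fin_bigcap_measurable => // i _.
  exact: (S_meas (SE i)).
have GT : G setT.
  exists fset0, (fun=> setT); split => //.
  by rewrite set_fset0 bigcap_set0.
have GI : setI_closed G.
  move=> _ _ [F1 [E1 [FJ1 SE1 ->]]] [F2 [E2 [FJ2 SE2 ->]]].
  exists (F1 `|` F2)%fset, (fun i => (if i \in F1 then E1 i else setT) `&`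
    (if i \in F2 then E2 i else setT)); split.
  - by move=> i /=; rewrite /mkset in_fsetU => /orP[]; [exact: FJ1|exact: FJ2].
  - by move=> i; apply: S_setI; case: ifP.
  - apply/seteqP; split => t /=.
      by move=> [h1 h2] i _ /=; split; case: ifP => // h; [exact: h1|exact: h2].
    move=> h; split => i /= iF; have := h i; rewrite /= in_fsetU iF ?orbT => /(_ isT)[]//.
have mB := S_meas SB.
have PB : P B \is a fin_num by exact: fin_num_measure.
pose c : {nonneg R} := NngNum (fine_ge0 (measure_ge0 P B)).
have cE : c%:num%:E = P B by rewrite /= fineK.
(* [P] restricted to [B] and [P] scaled by [P B] are finite measures; it suffices that they agree on
   the pi-system [G]. *)
suff : mrestr P mB A = mscale c P A.
  by rewrite /mrestr /mscale cE muleC.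
apply: (g_sigma_algebra_measure_unique G Gm (fun=> setT)) => //.
- by rewrite bigcup_const.
- move=> C GC; change (P (C `&` B) = c%:num%:E * P C)%E; rewrite cE.
  move: GC => [F [E [FJ SE ->]]].
  have jF : j \notin F by apply/negP => /FJ.
  pose E' i := if i == j then B else E i.
  have SE' i : S i (E' i) by rewrite /E'; case: eqVneq => [->|].
  rewrite (indep F E)//.
  have -> : \bigcap_(i in [set` F]) E i `&` B =
      \bigcap_(i in [set` (j |` F)%fset]) E' i.
    apply/seteqP; split => t /=.
      move=> [h Bt] i; rewrite /= in_fset1U /E' => /orP[->//|iF].
      by case: eqVneq => // _; exact: h.
    move=> h; split; last by have := h j; rewrite /= in_fset1U /E' eqxx; apply.
    move=> i /= iF; have := h i; rewrite /= in_fset1U iF orbT => /(_ isT).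
    by rewrite /E'; case: eqVneq => // ij; rewrite -ij iF in jF.
  rewrite (indep _ E')//= big_fsetU1//= /E' eqxx; congr (_ * _)%E.
  rewrite big_seq_cond [RHS]big_seq_cond; apply: eq_bigr => i /andP[iF _].
  by case: eqVneq => // ij; rewrite -ij iF in jF.
- by move=> _; rewrite -ge0_fin_numE//; exact: fin_num_measure.
- exact: sub_smallest2r SG _ sA.
Qed.

End independence.

Section product_law.
Context {dT dU dV : measure_display} {T : measurableType dT}
  {U : measurableType dU} {V : measurableType dV} {R : realType}.
Context (P : probability T R) (X : {RV P >-> U}) (Y : {RV P >-> V})
  (mu : probability V R).
Hypothesis XY_indep : forall A B, measurable A -> measurable B ->
  P (X @^-1` A `&` Y @^-1` B) = (P (X @^-1` A) * mu B)%E.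
Local Open Scope ereal_scope.

Let XY : {RV P >-> (U * V)%type} :=
  HB.pack (fun t => (X t, Y t)) (isMeasurableFun.Build _ _ _ _ _
   (measurable_fun_pair (@measurable_funPT _ _ _ _ X) (@measurable_funPT _ _ _ _ Y))).

(** Independence makes the joint law and the product measure agree on rectangles, which determine
    them; Tonelli and Fubini become available. *)
Let joint_law (h : U * V -> \bar R) :
  \int[distribution P XY]_p h p = \int[distribution P X \x mu]_p h p.
Proof.
apply: eq_measure_integral => /= C mC _; apply/esym.
by apply: product_measure_unique => // A B mA mB; rewrite -XY_indep.
Qed.

Lemma ge0_integral_indep (h : U * V -> \bar R) :
  measurable_fun setT h -> (forall p, 0 <= h p) ->
  \int[P]_t h (X t, Y t) = \int[P]_t \int[mu]_v h (X t, v).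
Proof.
move=> mh h0.
rewrite -[LHS](ge0_integral_distribution XY mh h0) joint_law.
rewrite fubini_tonelli1// -[RHS]/(\int[P]_t ((fubini_F mu h) \o X) t).
rewrite -ge0_integral_distribution//.
  exact: measurable_fun_fubini_tonelli_F.
by move=> u; apply: integral_ge0.
Qed.

Lemma integral_indep0 (h : U * V -> \bar R) :
  measurable_fun setT h -> P.-integrable setT (fun t => h (X t, Y t)) ->
  (forall t, \int[mu]_v h (X t, v) = 0) -> \int[P]_t h (X t, Y t) = 0.
Proof.
move=> mh ih h0.
(* Fubini needs integrability under the product law; [joint_law], applied to the absolute value,
   transfers it from the composed variable. *)
have iXY : (distribution P X \x mu).-integrable setT h.
  apply/integrableP; split => //; rewrite -joint_law.
  rewrite (ge0_integral_distribution XY) => [|//|//].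
    by case/integrableP : ih.
  exact: measurableT_comp.
rewrite -[LHS](integral_distribution (X := XY) mh ih) joint_law.
rewrite -integral12_prod_meas1//.
rewrite integral_distribution//.
- by apply: integral0_eq => t _ /=; exact: h0.
- exact: (measurable_fubini_F iXY).
- apply: (eq_integrable _ (cst 0)) => //; first by move=> t _ /=; apply/esym/h0.
  exact: integrable0.
Qed.

End product_law.

(** * Calculus under generalized smoothness *)

Section derivative_along_sequence.
Context {R : realType} {V : normedModType R}.

(** Limits along a sequence preserve measurability and pointwise bounds. The sign of [c] selects the
    side from which [a] is approached. *)
Lemma derivable_cvg_seq (g : V -> R) (a v : V) (c : R) :
  c != 0 -> derivable g a v ->
  (n.+1%:R / c) * (g (a + (c / n.+1%:R) *: v) - g a) @[n --> \oo] --> 'D_v g a.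
Proof.
move=> c0 dg.
have /cvgr_dnbhsP/(_ (fun n => c / n.+1%:R)) := dg.
have -> : (fun n => (n.+1%:R / c) * (g (a + (c / n.+1%:R) *: v) - g a)) =
  (fun n => (c / n.+1%:R)^-1 *: ((g \o shift a) ((c / n.+1%:R) *: v) - g a)).
  by apply/funext => n /=; rewrite invf_div (addrC a).
apply; split; first by move=> n; rewrite mulf_neq0// invr_eq0 pnatr_eq0.
rewrite -[X in _ --> X](mulr0 c); apply: cvgMr.
exact: cvg_harmonic.
Qed.

Lemma is_derive_line {W : normedModType R} (g : V -> W) (a v : V) (t : R) :
  derivable g (a + t *: v) v ->
  is_derive t 1 (fun s : R => g (a + s *: v)) ('D_v g (a + t *: v)).
Proof.
have E : (fun h : R => h^-1 *: (((fun s : R => g (a + s *: v)) \o shift t) (h *: (1 : R))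
      - g (a + t *: v))) =
    (fun h => h^-1 *: ((g \o shift (a + t *: v)) (h *: v) - g (a + t *: v))).
  apply/funext => h /=; rewrite [h *: (1 : R)]mulr1 scalerDl addrCA addrA.
  by rewrite (addrC a) -!addrA.
by move=> dg; apply: DeriveDef; rewrite /derivable /derive E.
Qed.

End derivative_along_sequence.

Section integral_of_derivative.
Context {R : realType}.
Local Notation mu := (@lebesgue_measure R).

Lemma measurable_derivative (phi phi' : R -> R) :
  (forall t : R, is_derive t 1 phi (phi' t)) -> measurable_fun setT phi'.
Proof.
move=> dphi.
have cphi : continuous phi.
  by move=> t; apply/differentiable_continuous/derivable1_diffP; case: (dphi t).
apply: (@measurable_fun_cvg _ (measurableTypeR R) R setT
  (fun n (t : R) => (n.+1%:R / 1) * (phi (t + (1 / n.+1%:R) *: (1 : R)) - phi t))).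
  move=> n; apply: measurable_funM => //; apply: measurable_funB.
    apply: measurableT_comp; first exact: continuous_measurable_fun.
    exact: measurable_funD.
  exact: continuous_measurable_fun.
move=> t _; have [dt <-] := dphi t.
exact: derivable_cvg_seq.
Qed.

(* The derivative is only bounded, not continuous: dominated convergence on the
   difference quotients, whose integrals telescope through a primitive of phi. *)
Lemma integral_bounded_derivative (phi phi' : R -> R) (C : R) :
  (forall t : R, is_derive t 1 phi (phi' t)) ->
  (forall s t, 0 <= s <= 2 -> 0 <= t <= 2 -> `|phi s - phi t| <= C * `|s - t|) ->
  (\int[mu]_(t in `[0%R, 1%R]) (phi' t)%:E = (phi 1 - phi 0)%:E)%E.
Proof.
move=> dphi phi_lip.
have cphi : continuous phi.
  by move=> t; apply/differentiable_continuous/derivable1_diffP; case: (dphi t).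
pose h n : R := 1 / n.+1%:R.
have h0 n : 0 < h n by rewrite divr_gt0.
(* Steps of length at most 1 keep [t + h n] in [[0, 2]], where [phi_lip] holds. *)
have h1 n : h n <= 1 by rewrite /h div1r invf_le1 ?ler1n.
pose Q n t := (h n)^-1 * (phi (t + h n) - phi t).
have QE n t : Q n t = (n.+1%:R / 1) * (phi (t + (1 / n.+1%:R) *: (1 : R)) - phi t).
  by rewrite /Q /h invf_div [_ *: _]mulr1.
have cQ n : continuous (Q n).
  move=> t; apply: cvgMr; apply: cvgB; last exact: cphi.
  apply: (@continuous_comp _ _ _ (fun t => t + h n) phi); last exact: cphi.
  by apply: cvgD; [exact: cvg_id|exact: cvg_cst].
have Qcvg : (\int[mu]_(t in `[0%R, 1%R]) (Q n t)%:E)%E @[n --> \oo] -->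
    (\int[mu]_(t in `[0%R, 1%R]) (phi' t)%:E)%E.
  have [] := @dominated_convergence _ _ _ mu `[0%R, 1%R]%classic _
    (fun n t => (Q n t)%:E) (EFin \o phi') (cst C%:E) => //.
  - move=> n; apply/measurable_EFinP; apply: measurable_funTS.
    exact: continuous_measurable_fun.
  - by apply/measurable_EFinP/measurable_funTS; exact: measurable_derivative dphi.
  - apply: aeW => t _; apply: cvg_EFin; first by apply: nearW.
    under eq_fun do rewrite /= QE.
    by have [dt <-] := dphi t; exact: derivable_cvg_seq.
  - apply/integrableP; split=> //.
    rewrite integral_cst//= lebesgue_measure_itv/= lte_fin ltr01 sube0 mule1.
    by rewrite ltry.
  - apply: aeW => t n; rewrite /= in_itv/= => /andP[t0 t1].
    rewrite lee_fin /Q normrM gtr0_norm ?invr_gt0// ler_pdivrMl//.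
    rewrite (le_trans (phi_lip _ _ _ _))//.
    + by have := h0 n; have := h1 n; lra.
    + by lra.
    + by rewrite addrAC subrr add0r gtr0_norm// mulrC.
(* Starting the primitive at -1 makes it differentiable at 0 as well as at 1. *)
pose Phi x := (\int[mu]_(t in `[-1, x]) phi t)%R.
have dPhi (x : R) : -1 < x -> is_derive x 1 Phi (phi x).
  move=> x0; have [] := @continuous_FTC1_closed R phi (-1) x (x + 1).
  - by rewrite ltrDl.
  - apply: continuous_compact_integrable; first exact: segment_compact.
    exact: continuous_subspaceT.
  - by [].
  - exact: cphi.
  - by move=> dx; rewrite derive1E => e; exact: DeriveDef.
(* The integral of the quotients of [phi] telescopes to the quotients of [Phi] at 1 and at 0, which
   tend to [phi 1] and [phi 0]. *)
have QI n : (\int[mu]_(t in `[0%R, 1%R]) (Q n t)%:E =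
    ((n.+1%:R / 1) * (Phi (1 + (1 / n.+1%:R) *: (1 : R)) - Phi 1)
     - (n.+1%:R / 1) * (Phi (0 + (1 / n.+1%:R) *: (1 : R)) - Phi 0))%:E)%E.
  pose F t := (h n)^-1 * (Phi (t + h n) - Phi t).
  have dF (t : R) : -1 < t -> is_derive t 1 F (Q n t).
    move=> t1.
    have t1' : -1 < t + h n by have := h0 n; lra.
    have d1 := dPhi _ t1; have d2 := dPhi _ t1'.
    have d3 : is_derive t 1 (fun t => Phi (t + h n)) (phi (t + h n)).
      have [d2' <-] := d2.
      rewrite (_ : (fun t => _) = (fun t : R => Phi (h n + t *: (1 : R)))).
        rewrite (_ : t + h n = h n + t *: (1 : R)).
          apply: is_derive_line; rewrite [_ *: _]mulr1 addrC//.
        by rewrite [_ *: _]mulr1 addrC.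
      by apply/funext => s; rewrite [_ *: _]mulr1 addrC.
    have d4 : is_derive t 1 (fun t => Phi (t + h n) - Phi t) (phi (t + h n) - phi t).
      exact: is_deriveB.
    exact: is_deriveZ.
  rewrite (@continuous_FTC2 _ _ F)//.
  - rewrite -EFinB; congr EFin; rewrite /F /h invf_div ![_ *: _]mulr1; ring.
  - by apply: continuous_subspaceT => t; exact: cQ.
  - have cF (t : R) : -1 < t -> {for t, continuous F}.
      by move=> /dF[+ _] => /derivable1_diffP/differentiable_continuous.
    split.
    + by move=> t; rewrite in_itv/= => /andP[t0 _]; case: (dF t) => //; lra.
    + by apply: cvg_at_right_filter; apply: cF; lra.
    + by apply: cvg_at_left_filter; apply: cF; lra.
  - move=> t; rewrite in_itv/= => /andP[t0 _]; rewrite derive1E.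
    by case: (dF t) => //; lra.
move: Qcvg; rewrite (funext QI) => Qcvg.
apply: (cvg_unique _ Qcvg) => //; apply: cvg_EFin; first exact: nearW.
apply: cvgB.
- by have [d1 <-] := dPhi 1 ltac:(lra); exact: derivable_cvg_seq.
- by have [d1 <-] := dPhi 0 ltac:(lra); exact: derivable_cvg_seq.
Qed.

End integral_of_derivative.

Section hessian.
Context {R : realType} {d : nat} (h : 'rV[R]_d -> R).
Hypothesis h_diff : twice_differentiable h.

Lemma continuous_grad : continuous (grad h).
Proof. by move=> x; apply: differentiable_continuous; exact: h_diff.2. Qed.

Lemma hessE x v : v *m hess h x = 'D_v (grad h) x.
Proof. by rewrite -deriveEjacobian//; exact: h_diff.2. Qed.

Lemma derivable_grad_coord x v i : derivable (fun y => grad h y ord0 i) x v.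
Proof. by have /derivable_mxP := @diff_derivable _ _ _ _ _ v (h_diff.2 x); exact. Qed.

Lemma hess_coord x v i :
  (v *m hess h x) ord0 i = 'D_v (fun y => grad h y ord0 i) x.
Proof.
by rewrite hessE derive_mx ?mxE//; apply/diff_derivable; exact: h_diff.2.
Qed.

Lemma derive_dot_grad x v : 'D_v h x = dot (grad h x) v.
Proof.
have E w : 'd h x w = 'D_w h x by rewrite deriveE//; exact: h_diff.1.
rewrite -E {1}(row_sum_delta v) linear_sum; apply: eq_bigr => i _.
by rewrite linearZ /grad mxE -E [RHS]mulrC.
Qed.

Lemma is_derive_grad_line x v i (t : R) :
  is_derive t 1 (fun s : R => grad h (x + s *: v) ord0 i)
    ((v *m hess h (x + t *: v)) ord0 i).
Proof.
rewrite hess_coord.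
apply: (is_derive_line (g := fun y => grad h y ord0 i)).
exact: derivable_grad_coord.
Qed.

Lemma is_derive_dot_grad_line x v w (t : R) :
  is_derive t 1 (fun s : R => dot (grad h (x + s *: v)) w)
    (dot (v *m hess h (x + t *: v)) w).
Proof.
rewrite /dot (_ : (fun s : R => _) = \sum_(i < d)
  (fun s : R => grad h (x + s *: v) ord0 i * w ord0 i)); last first.
  by apply/funext => s; rewrite fct_sumE.
apply: is_derive_sum => i.
rewrite (_ : (fun s : R => _) =
    w ord0 i \*: (fun s : R => grad h (x + s *: v) ord0 i)); last first.
  by apply/funext => s /=; rewrite mulrC.
by rewrite mulrC; apply: is_deriveZ; exact: is_derive_grad_line.
Qed.

Lemma hess_cvg x v i :
  n.+1%:R * (grad h (x + (1 / n.+1%:R) *: v) ord0 i - grad h x ord0 i)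
    @[n --> \oo] --> (v *m hess h x) ord0 i.
Proof.
rewrite hess_coord.
have := derivable_cvg_seq (oner_neq0 R) (@derivable_grad_coord x v i).
by under eq_fun do rewrite divr1.
Qed.

End hessian.

Section generalized_smoothness.
Context {R : realType} {d : nat} (N : 'rV[R]_d -> R) (N_norm : is_norm N).
Context (theta_lo rho_hi : R) (theta_lo_gt0 : 0 < theta_lo).
Hypothesis N_lb : forall u, theta_lo * norm2 u <= N u.
Hypothesis dual_ub : forall u, dual_norm N u <= rho_hi * norm2 u.
Local Notation dn := (dual_norm N).

Lemma continuous_dual_norm : continuous dn.
Proof.
(* A Lipschitz constant with respect to the sup norm; the summand 1 keeps it positive in dimension
   0. *)
pose C := `|rho_hi| * Num.sqrt d%:R + 1.
have C0 : 0 < C by rewrite ltr_wpDl// mulr_ge0 ?sqrtr_ge0.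
have dC w : dn w <= C * `|w|.
  rewrite (le_trans (dual_ub w))// mulrDl mul1r.
  rewrite (@le_trans _ _ (`|rho_hi| * norm2 w)) ?ler_wpM2r ?norm2_ge0 ?ler_norm//.
  by rewrite -mulrA ler_wpDr// ler_wpM2l// norm2_mx_norm.
move=> u A /= /nbhs_ballP[e /= e0 eA].
apply/nbhs_ballP; exists (e / C); first by rewrite /= divr_gt0.
move=> v; rewrite -ball_normE /ball_ /= ltr_pdivlMr// mulrC => uv.
apply: eA; rewrite -ball_normE /ball_ /=.
have h1 := dual_normD N_norm theta_lo_gt0 N_lb (u - v) v.
have h2 := dual_normD N_norm theta_lo_gt0 N_lb (- (u - v)) u.
rewrite (dual_normN N_norm theta_lo_gt0 N_lb) in h2.
have h3 := dC (u - v).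
move: h1 h2; rewrite subrK opprB subrK ltr_norml; lra.
Qed.

Context (f : 'rV[R]_d -> R) (f_diff : twice_differentiable f) (L0 L1 : R).
Context (L0_ge0 : 0 <= L0) (L1_gt0 : 0 < L1).
Hypothesis A3 : symmetric_L0L1_lipschitz N L0 L1 f.
Implicit Types (x v : 'rV[R]_d) (s t : R).
Local Notation g := (fun x => dn (grad f x)).

Let L1_ge0 : 0 <= L1. Proof. exact: ltW. Qed.
Let dn_ge0 w : 0 <= dn w.
Proof. exact: (dual_norm_ge0 N_norm theta_lo_gt0 N_lb). Qed.

Lemma continuous_dual_grad : continuous g.
Proof.
move=> x; apply: (continuous_comp (@continuous_grad _ _ _ f_diff x)).
exact: continuous_dual_norm.
Qed.

(** [S] is the maximum of the gradient norm on the segment, attained by compactness. The Lipschitz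
    bound between the maximum point and [x] then bounds [S] in terms of itself. The length of [v] is
    arbitrary, which [integral_hess_line] relies on. *)
Lemma grad_segment x v : exists S, [/\ 0 <= S,
  forall s, 0 <= s <= 1 -> g (x + s *: v) <= S,
  S <= g x + (L0 + L1 * S) * N v &
  forall s t, 0 <= s <= 1 -> 0 <= t <= 1 ->
    dn (grad f (x + s *: v) - grad f (x + t *: v)) <=
    (L0 + L1 * S) * (`|s - t| * N v)].
Proof.
have gc : continuous (fun s => g (x + s *: v)).
  move=> s; apply: (@continuous_comp _ _ _ (fun s => x + s *: v) g); last first.
    exact: continuous_dual_grad.
  by apply: cvgD; [exact: cvg_cst|apply: cvgZr_tmp; exact: cvg_id].
have [c] := EVT_max ler01 (continuous_subspaceT gc).
rewrite in_itv/= => c01 cP.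
have lip s t : 0 <= s <= 1 -> 0 <= t <= 1 ->
    dn (grad f (x + s *: v) - grad f (x + t *: v)) <=
    (L0 + L1 * g (x + c *: v)) * (`|s - t| * N v).
  move=> s01 t01.
  have E : N (x + s *: v - (x + t *: v)) = `|s - t| * N v.
    by rewrite -(is_norm_homogeneous N_norm) opprD addrACA subrr add0r scalerBl.
  rewrite -E (le_trans (A3 _ _))// ler_wpM2r ?is_norm_ge0// lerD2l ler_pM2l//.
  apply: ge_sup.
    by exists (g (1 *: (x + s *: v) + (1 - 1) *: (x + t *: v))); exists 1;
      rewrite //= in_itv/= ler01 lexx.
  move=> y [r /=]; rewrite in_itv/= => r01 <-{y}.
  have -> : r *: (x + s *: v) + (1 - r) *: (x + t *: v) =
      x + (r * s + (1 - r) * t) *: v.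
    rewrite !scalerDr !scalerA addrACA -!scalerDl.
    by rewrite (addrC r) subrK scale1r.
  by apply: cP; rewrite in_itv/=; nra.
exists (g (x + c *: v)); split => //.
have := lip c 0 c01; rewrite lexx ler01 => /(_ isT).
  rewrite scale0r addr0 subr0.
  have := dual_normD N_norm theta_lo_gt0 N_lb (grad f (x + c *: v) - grad f x) (grad f x).
  rewrite subrK => h1 h2; rewrite (le_trans h1)// addrC lerD2l (le_trans h2)//.
  rewrite ler_wpM2l//.
    exact: addr_ge0 L0_ge0 (mulr_ge0 L1_ge0 (dn_ge0 _)).
  move: c01 => /andP[c0 c1].
  by rewrite ger0_norm// ler_piMl ?is_norm_ge0.
Qed.

(** Multiplying the self-bound of [S] by [L1] and adding [L0] gives
    [(1 - 1/80) (L0 + L1 S) <= L0 + L1 g x], which is the origin of [80 / 79]. *)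
Lemma grad_lipschitz_segment x v s t : L1 * N v <= 80^-1 ->
  0 <= s <= 1 -> 0 <= t <= 1 ->
  dn (grad f (x + s *: v) - grad f (x + t *: v)) <=
  80 / 79 * (L0 + L1 * g x) * (`|s - t| * N v).
Proof.
move=> Lv s01 t01; have [S [S0 _ SP lip]] := grad_segment x v.
rewrite (le_trans (lip s t s01 t01))// ler_wpM2r//.
  by rewrite mulr_ge0 ?is_norm_ge0.
have h : L1 * S <= L1 * g x + (L0 + L1 * S) * (L1 * N v).
  by rewrite mulrCA -mulrDr ler_pM2l.
have h' : (L0 + L1 * S) * (L1 * N v) <= (L0 + L1 * S) * 80^-1.
  by rewrite ler_wpM2l//; exact: addr_ge0 L0_ge0 (mulr_ge0 L1_ge0 S0).
lra.
Qed.

Lemma grad_step x v : L1 * N v <= 80^-1 ->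
  dn (grad f (x + v) - grad f x) <= 80 / 79 * (L0 + L1 * g x) * N v.
Proof.
move=> Lv; have := @grad_lipschitz_segment x v 1 0 Lv.
by rewrite scale1r scale0r addr0 subr0 normr1 mul1r !lexx !ler01 => /(_ isT isT).
Qed.

(** The Hessian along [v] is a limit of gradient quotients, each bounded by the Lipschitz constant
    of the segment; testing against [w] in the unit ball turns this into scalar limits. *)
Lemma hess_segment x v t : L1 * N v <= 80^-1 -> 0 <= t <= 1 ->
  dn (v *m hess f (x + t *: v)) <= 80 / 79 * (L0 + L1 * g x) * N v.
Proof.
move=> Lv t01; set C := _ * N v.
apply: (dual_norm_le N_norm theta_lo_gt0 N_lb) => w Nw.
pose psi := fun s : R => dot (grad f (x + s *: v)) w.
(* The increment points away from the nearer endpoint, so [t + c / n.+1%:R] stays in [[0, 1]]. *)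
pose c : R := if t <= 2^-1 then 2^-1 else - 2^-1.
have c0 : c != 0 by rewrite /c; case: ifP => _; rewrite ?oppr_eq0 invr_eq0.
have [dpsi <-] := is_derive_dot_grad_line f_diff x v w t.
have psi_cvg := derivable_cvg_seq c0 dpsi.
apply: (cvgr_to_le psi_cvg); apply: nearW => n.
have -> : n.+1%:R / c = (c / n.+1%:R)^-1 by rewrite invf_div.
have : 0 <= t + c / n.+1%:R <= 1 /\ c / n.+1%:R != 0.
  split; last by rewrite mulf_neq0// invr_eq0 pnatr_eq0.
  have n1 : 0 < (n.+1%:R^-1 : R) <= 1 by rewrite invr_gt0 ltr0n/= invf_le1 ?ler1n.
  move: (n.+1%:R^-1) n1 => r /andP[r0 r1]; rewrite /c; case: ifPn; rewrite -?ltNge; nra.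
rewrite (_ : (c / n.+1%:R) *: (1 : R) = c / n.+1%:R); last exact: mulr1.
move: (c / n.+1%:R) => h [h01 h0].
rewrite -dotNl -dotDl -dotZl.
have h2 := dot_le_dual N_norm theta_lo_gt0 N_lb.
rewrite (le_trans (h2 _ _))//.
rewrite (@le_trans _ _ (dn (h^-1 *: (grad f (x + (t + h) *: v) - grad f (x + t *: v)))))//.
  by rewrite ler_piMr// (dual_norm_ge0 N_norm theta_lo_gt0 N_lb).
rewrite (le_trans (dual_normZ_le N_norm theta_lo_gt0 N_lb _ _))//.
rewrite normfV ler_pdivrMl ?normr_gt0//.
rewrite (le_trans (grad_lipschitz_segment _ Lv h01 t01))//.
by rewrite addrAC subrr add0r /C mulrCA.
Qed.

(** The mean value theorem at one point [c] is enough; bounding [c] by 1 gives up the factor 1/2 of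
    the integral remainder, for which the final constants have room. *)
Lemma descent x v : L1 * N v <= 80^-1 ->
  f (x + v) <= f x + dot (grad f x) v + 80 / 79 * (L0 + L1 * g x) * N v ^+ 2.
Proof.
move=> Lv.
have df (t : R) : is_derive t 1 (fun s : R => f (x + s *: v)) (dot (grad f (x + t *: v)) v).
  rewrite -derive_dot_grad//; apply: is_derive_line.
  by apply: diff_derivable; exact: f_diff.1.
have cf : {within `[0, 1], continuous (fun s : R => f (x + s *: v))}.
  apply: continuous_subspaceT => t.
  by have [+ _] := df t => /derivable1_diffP/differentiable_continuous.
have [c] := MVT_segment ler01 (fun t _ => df t) cf.
rewrite in_itv/= => c01; rewrite scale1r scale0r addr0 subr0 mulr1 => E.
have h1 := dot_le_dual N_norm theta_lo_gt0 N_lb (grad f (x + c *: v) - grad f x) v.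
have := @grad_lipschitz_segment x v c 0 Lv c01.
rewrite lexx ler01 => /(_ isT); rewrite scale0r addr0 subr0 => h2.
have : dn (grad f (x + c *: v) - grad f x) * N v <=
    80 / 79 * (L0 + L1 * g x) * N v ^+ 2.
  rewrite expr2 mulrA ler_wpM2r ?is_norm_ge0// (le_trans h2)//.
  move: c01 => /andP[c0 c1]; rewrite ger0_norm//.
  rewrite ler_wpM2l ?ler_piMl ?is_norm_ge0// mulr_ge0 ?divr_ge0//.
  exact: addr_ge0 L0_ge0 (mulr_ge0 L1_ge0 (dn_ge0 _)).
move: h1; rewrite dotDl dotNl; lra.
Qed.

(** The integrand is the derivative of [dot (grad f (x + s *: v)) w + m * s] in [s], and the linear
    term makes the values at 0 and 1 agree. *)
Lemma integral_hess_line x v w :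
  (\int[lebesgue_measure]_(t in `[0%R, 1%R])
     (dot (grad f x - grad f (x + v) + v *m hess f (x + t *: v)) w)%:E = 0)%E.
Proof.
(* The doubled segment provides the Lipschitz bound on [[0, 2]] that [integral_bounded_derivative]
   asks for. *)
have [S [S0 _ _ lip]] := grad_segment x (2 *: v).
have abs_dot u : `|dot u w| <= dn u * N w.
  have h2 := dot_le_dual N_norm theta_lo_gt0 N_lb (- u) w.
  rewrite dotNl (dual_normN N_norm theta_lo_gt0 N_lb) in h2.
  by rewrite ler_norml lerNl h2 (dot_le_dual N_norm theta_lo_gt0 N_lb).
pose m := dot (grad f x - grad f (x + v)) w.
have dphi (t : R) : is_derive t 1
    ((fun s : R => dot (grad f (x + s *: v)) w) + m \*: (@idfun R))
    (dot (grad f x - grad f (x + v) + v *m hess f (x + t *: v)) w).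
  rewrite dotDl [X in is_derive _ _ _ X]addrC; apply: is_deriveD; first exact: is_derive_dot_grad_line.
  have := @is_deriveZ _ _ _ _ m _ _ _ (is_derive_id t (1 : R)).
  by rewrite [_ *: _]mulr1.
have := @integral_bounded_derivative _ _ _
  ((L0 + L1 * S) * N v * N w + `|m|) dphi.
rewrite /= !fctE /= scale1r scale0r addr0 !scaler0.
have -> : dot (grad f (x + v)) w + m *: (1 : R) - (dot (grad f x) w + 0) = 0.
  by rewrite [m *: (1 : R)]mulr1 /m dotDl dotNl; lra.
apply => s t s02 t02.
rewrite opprD addrACA -scalerBr -dotNl -dotDl.
rewrite (le_trans (ler_normD _ _))// mulrDl lerD//; last by rewrite normrM.
rewrite (le_trans (abs_dot _))// [leRHS]mulrAC ler_wpM2r ?is_norm_ge0//.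
have := lip (s / 2) (t / 2); rewrite !scalerA !divfK//.
have -> : `|s / 2 - t / 2| * N (2 *: v) = `|s - t| * N v.
  rewrite -mulrBl (is_norm_homogeneous N_norm) normrM normfV mulrA divfK//.
  by rewrite normr_eq0 pnatr_eq0.
by move=> h; rewrite (le_trans (h _ _)) -?mulrA 1?(mulrC `|s - t|)//; lra.
Qed.

End generalized_smoothness.

(** * First and second moments *)

Section has_mean_theory.
Context {dT : measure_display} {T : measurableType dT} {R : realType}.
Context (P : probability T R).
Implicit Types (X Y : T -> R) (r s : R).

Lemma has_mean_integral X r : P.-integrable setT (EFin \o X) ->
  (\int[P]_t (X t)%:E = r%:E)%E -> has_mean P X r.
Proof. by move=> iX e; split => //; rewrite unlock. Qed.

Lemma integral_has_mean X r : has_mean P X r -> (\int[P]_t (X t)%:E = r%:E)%E.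
Proof. by case=> _; rewrite unlock. Qed.

Lemma has_mean_measurable X r : has_mean P X r -> measurable_fun setT X.
Proof. by case=> /integrableP[/measurable_EFinP]. Qed.

Lemma has_mean_cst r : has_mean P (cst r) r.
Proof.
split; last exact: expectation_cst.
exact: finite_measure_integrable_cst.
Qed.

Lemma has_meanD X Y r s : has_mean P X r -> has_mean P Y s ->
  has_mean P (fun t => X t + Y t) (r + s).
Proof.
move=> hX hY; have [[iX _] [iY _]] := (hX, hY).
apply: has_mean_integral; first exact: integrableD iX iY.
under eq_integral do rewrite EFinD.
by rewrite integralD// (integral_has_mean hX) (integral_has_mean hY).
Qed.

Lemma has_meanZ X a r : has_mean P X r -> has_mean P (fun t => a * X t) (a * r).
Proof.
move=> hX; have [iX _] := hX.
apply: has_mean_integral; first exact: (integrableZl _ a iX).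
under eq_integral do rewrite EFinM.
by rewrite integralZl// (integral_has_mean hX).
Qed.

Lemma has_mean_centered X a r : has_mean P X r ->
  has_mean P (fun t => a * (X t - r)) 0.
Proof.
move=> hX; have := has_meanZ a (has_meanD hX (has_mean_cst (- r))).
by rewrite subrr mulr0.
Qed.

Lemma has_mean_sum (I : Type) (q : seq I) (X : I -> T -> R) (r : I -> R) :
  (forall i, has_mean P (X i) (r i)) ->
  has_mean P (fun t => \sum_(i <- q) X i t) (\sum_(i <- q) r i).
Proof.
move=> hX; elim: q => [|i q ih].
  under eq_fun do rewrite big_nil.
  by rewrite big_nil; exact: has_mean_cst.
under eq_fun do rewrite big_cons.
by rewrite big_cons; exact: has_meanD.
Qed.

Lemma has_mean_mono X Y r s : has_mean P X r -> has_mean P Y s ->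
  (forall t, X t <= Y t) -> r <= s.
Proof.
move=> hX hY XY; have [[iX _] [iY _]] := (hX, hY).
rewrite -lee_fin -(integral_has_mean hX) -(integral_has_mean hY).
by apply: le_integral => // t _; rewrite lee_fin.
Qed.

Lemma has_mean_ge0 X r : has_mean P X r -> (forall t, 0 <= X t) -> 0 <= r.
Proof. move=> hX; exact: has_mean_mono (has_mean_cst 0) hX. Qed.

Lemma has_mean_exists X r : measurable_fun setT X -> (forall t, 0 <= X t) ->
  (\int[P]_t (X t)%:E <= r%:E)%E -> exists2 s, has_mean P X s & s <= r.
Proof.
move=> mX X0 Xr.
have iX : P.-integrable setT (EFin \o X).
  apply/integrableP; split; first exact/measurable_EFinP.
  under eq_integral do rewrite gee0_abs ?lee_fin//.
  by rewrite (le_lt_trans Xr)// ltry.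
have fX : (\int[P]_t (X t)%:E)%E \is a fin_num by exact: integrable_fin_num.
exists (fine (\int[P]_t (X t)%:E)%E); last by rewrite -lee_fin fineK.
by apply: has_mean_integral => //; rewrite fineK.
Qed.

Lemma has_mean_dominated X Y s : measurable_fun setT X ->
  (forall t, `|X t| <= Y t) -> has_mean P Y s -> exists r, has_mean P X r.
Proof.
move=> mX XY [iY _].
have iX : P.-integrable setT (EFin \o X).
  apply: le_integrable iY => //; first exact/measurable_EFinP.
  by move=> t _; rewrite lee_fin (le_trans (XY t))// ler_norm.
exists (fine (\int[P]_t (X t)%:E)%E).
by apply: has_mean_integral => //; rewrite fineK//; exact: integrable_fin_num.
Qed.

End has_mean_theory.

Section vector_measurable.
Context {dT : measure_display} {T : measurableType dT} {R : realType} {d : nat}.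
Implicit Types X Y : T -> borel_rV R d.

Lemma measurable_rVD X Y : measurable_fun setT X -> measurable_fun setT Y ->
  measurable_fun setT (fun t => (X t : 'rV_d) + Y t : borel_rV R d).
Proof.
move=> mX mY; apply: measurable_rV => i; under eq_fun do rewrite mxE.
by apply: measurable_funD; exact: measurable_rV_coord.
Qed.

Lemma measurable_rVZ (a : T -> R) X :
  measurable_fun setT a -> measurable_fun setT X ->
  measurable_fun setT (fun t => a t *: (X t : 'rV_d) : borel_rV R d).
Proof.
move=> ma mX; apply: measurable_rV => i; under eq_fun do rewrite mxE.
by apply: measurable_funM => //; exact: measurable_rV_coord.
Qed.

Lemma measurable_rVB X Y : measurable_fun setT X -> measurable_fun setT Y ->
  measurable_fun setT (fun t => (X t : 'rV_d) - Y t : borel_rV R d).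
Proof.
move=> mX mY; apply: measurable_rV => i; under eq_fun do rewrite !mxE.
by apply: measurable_funB; exact: measurable_rV_coord.
Qed.

Lemma measurable_rV_mulmx X (H : T -> 'M[R]_d) : measurable_fun setT X ->
  (forall i j, measurable_fun setT (fun t => H t i j)) ->
  measurable_fun setT (fun t => (X t : 'rV_d) *m H t : borel_rV R d).
Proof.
move=> mX mH; apply: measurable_rV => j; under eq_fun do rewrite mxE.
by apply: measurable_sum => i; apply: measurable_funM => //; exact: measurable_rV_coord.
Qed.

Lemma measurable_dot X Y : measurable_fun setT X -> measurable_fun setT Y ->
  measurable_fun setT (fun t => dot (X t) (Y t)).
Proof.
move=> mX mY; apply: measurable_sum => i.
by apply: measurable_funM; exact: measurable_rV_coord.
Qed.

Lemma measurable_sqr_norm2 X : measurable_fun setT X ->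
  measurable_fun setT (fun t => norm2 (X t) ^+ 2).
Proof.
by move=> mX; under eq_fun do rewrite sqr_norm2; exact: measurable_dot.
Qed.

Lemma measurable_norm2 X : measurable_fun setT X ->
  measurable_fun setT (fun t => norm2 (X t)).
Proof.
move=> mX; apply: (measurableT_comp (f := @Num.sqrt R)); last exact: measurable_dot.
by apply: continuous_measurable_fun; exact: sqrt_continuous.
Qed.

End vector_measurable.

Section second_moment.
Context {dT : measure_display} {T : measurableType dT} {R : realType} {d : nat}.
Context (P : probability T R).
Implicit Types M Y : T -> borel_rV R d.

(** Integrates [|M| <= e / 2 + |M|^2 / (2 e)]. The best choice [e = s] may vanish, so [s] is
    enlarged by an arbitrary positive number. *)
Lemma has_mean_norm2 M (a s : R) : measurable_fun setT M -> 0 <= s -> a <= s ^+ 2 ->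
  has_mean P (fun t => norm2 (M t) ^+ 2) a ->
  exists2 r, has_mean P (fun t => norm2 (M t)) r & r <= s.
Proof.
move=> mM s0 as2 hM.
have bound (e : R) t : 0 < e -> `|norm2 (M t)| <= 2^-1 * e + (2 * e)^-1 * norm2 (M t) ^+ 2.
  move=> e0; rewrite ger0_norm ?norm2_ge0//.
  have -> : 2^-1 * e + (2 * e)^-1 * norm2 (M t) ^+ 2 =
      norm2 (M t) + (e - norm2 (M t)) ^+ 2 / (2 * e).
    by field; rewrite gt_eqF.
  by rewrite lerDl divr_ge0 ?sqr_ge0// mulr_ge0// ltW.
have hb (e : R) := has_meanD (has_mean_cst P (2^-1 * e)) (has_meanZ (2 * e)^-1 hM).
have [r hr] := has_mean_dominated (measurable_norm2 mM) (fun t => bound 1 t ltr01) (hb 1).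
exists r => //; apply/ler_addgt0Pr => e e0.
have se : 0 < s + e by rewrite ltr_wpDl.
have /le_trans -> // := has_mean_mono hr (hb (s + e))
  (fun t => le_trans (ler_norm _) (bound _ t se)).
rewrite -(ler_pM2l (_ : 0 < 2 * (s + e))) ?mulr_gt0//.
have -> : 2 * (s + e) * (2^-1 * (s + e) + (2 * (s + e))^-1 * a) = (s + e) ^+ 2 + a.
  by field; rewrite gt_eqF.
nra.
Qed.

(** When the square is expanded around [M], the three cross terms with [M] have mean zero. The
    innovations are combined by [sqr_norm2D3_le], the source of the factor 3. *)
Lemma second_moment_step M Y1 Y2 Y3 (beta alpha a c1 c2 c3 : R) :
  0 <= beta <= 1 ->
  measurable_fun setT M -> measurable_fun setT Y1 ->
  measurable_fun setT Y2 -> measurable_fun setT Y3 ->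
  has_mean P (fun t => norm2 (M t) ^+ 2) a ->
  has_mean P (fun t => norm2 (Y1 t) ^+ 2) c1 ->
  has_mean P (fun t => norm2 (Y2 t) ^+ 2) c2 ->
  has_mean P (fun t => norm2 (Y3 t) ^+ 2) c3 ->
  has_mean P (fun t => dot (M t) (Y1 t)) 0 ->
  has_mean P (fun t => dot (M t) (Y2 t)) 0 ->
  has_mean P (fun t => dot (M t) (Y3 t)) 0 ->
  exists2 a', has_mean P (fun t =>
    norm2 (beta *: ((M t : 'rV_d) + Y1 t + Y2 t) + alpha *: (Y3 t : 'rV_d)) ^+ 2) a' &
    a' <= beta ^+ 2 * a + 3 * (c1 + c2 + alpha ^+ 2 * c3).
Proof.
move=> /andP[b0 b1] mM m1 m2 m3 hM h1 h2 h3 o1 o2 o3.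
(* The expanded square, with the factors [beta ^+ 2 <= 1] of [Y1] and [Y2] dropped from the
   quadratic part; it dominates the integrand and its mean is known. *)
pose U t := beta ^+ 2 * norm2 (M t) ^+ 2 +
  3 * ((norm2 (Y1 t) ^+ 2 + norm2 (Y2 t) ^+ 2) + alpha ^+ 2 * norm2 (Y3 t) ^+ 2) +
  (2 * beta ^+ 2 * dot (M t) (Y1 t) + 2 * beta ^+ 2 * dot (M t) (Y2 t) +
   2 * beta * alpha * dot (M t) (Y3 t)).
have hU : has_mean P U (beta ^+ 2 * a + 3 * (c1 + c2 + alpha ^+ 2 * c3)).
  have hY := has_meanZ 3 (has_meanD (has_meanD h1 h2) (has_meanZ (alpha ^+ 2) h3)).
  have hO := has_meanD (has_meanD (has_meanZ (2 * beta ^+ 2) o1)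
    (has_meanZ (2 * beta ^+ 2) o2)) (has_meanZ (2 * beta * alpha) o3).
  rewrite !mulr0 !addr0 in hO.
  by have := has_meanD (has_meanD (has_meanZ (beta ^+ 2) hM) hY) hO; rewrite addr0.
pose X t := norm2 (beta *: ((M t : 'rV_d) + Y1 t + Y2 t) + alpha *: (Y3 t : 'rV_d)) ^+ 2.
have XU t : `|X t| <= U t.
  rewrite ger0_norm ?sqr_ge0// /X /U.
  have h := sqr_norm2D3_le (beta *: (Y1 t : 'rV_d)) (beta *: (Y2 t : 'rV_d)) (alpha *: (Y3 t : 'rV_d)).
  have -> : beta *: ((M t : 'rV_d) + Y1 t + Y2 t) + alpha *: (Y3 t : 'rV_d) =
      beta *: (M t : 'rV_d) + (beta *: (Y1 t : 'rV_d) + beta *: (Y2 t : 'rV_d)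
        + alpha *: (Y3 t : 'rV_d)).
    by rewrite !scalerDr !addrA.
  rewrite sqr_norm2D.
  move: h; rewrite !norm2Z !exprMn !real_normK ?num_real// => h.
  rewrite !(dotDr, dotZr, dotZl).
  have bb : beta ^+ 2 <= 1 by nra.
  have := sqr_ge0 (norm2 (Y1 t)); have := sqr_ge0 (norm2 (Y2 t)).
  move: h; set A1 := norm2 (Y1 t) ^+ 2; set A2 := norm2 (Y2 t) ^+ 2.
  set A3 := norm2 (Y3 t) ^+ 2; set B2 := beta ^+ 2 => h A20 A10.
  have hA1 : B2 * A1 <= A1 by rewrite ler_piMl.
  have hA2 : B2 * A2 <= A2 by rewrite ler_piMl.
  have EB : B2 = beta * beta by rewrite /B2 expr2.
  rewrite EB in h hA1 hA2 *; lra.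
have mX : measurable_fun setT X.
  apply: measurable_sqr_norm2; apply: measurable_rVD; apply: measurable_rVZ => //.
  by apply: measurable_rVD => //; exact: measurable_rVD.
have [r hr] := has_mean_dominated mX XU hU.
by exists r => //; apply: (has_mean_mono hr hU) => t; exact: le_trans (ler_norm _) (XU t).
Qed.

End second_moment.

(** * Measurability of derivatives and fresh randomness *)

Lemma delta_mulmx {R : realType} {d : nat} (H : 'M[R]_d) i j :
  ((delta_mx ord0 i : 'rV_d) *m H) ord0 j = H i j.
Proof. by rewrite -rowE mxE. Qed.

Lemma continuous_addr_rV {R : realType} {d : nat} (v : 'rV[R]_d) :
  continuous (fun x : 'rV[R]_d => x + v).
Proof.
move=> x A /= /nbhs_ballP[e /= e0 eA].
apply/nbhs_ballP; exists e => //= y; rewrite -ball_normE /ball_ /= => xy.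
by apply: eA; rewrite -ball_normE /ball_ /= opprD addrACA subrr addr0.
Qed.

Section measurable_derivatives.
Context {R : realType} {d : nat} {dZ : measure_display} {Z : measurableType dZ}.

(** The gradient is continuous, the Hessian need not be; its entries are pointwise limits of
    difference quotients of the gradient. *)
Lemma measurable_hess (h : 'rV[R]_d -> R) i j : twice_differentiable h ->
  measurable_fun setT (fun x : borel_rV R d => hess h x i j).
Proof.
move=> hd; have gc k : continuous (fun x => grad h x ord0 k).
  move=> x.
  exact: (continuous_comp (@continuous_grad _ _ _ hd x) (@coord_continuous _ _ _ ord0 k _)).
apply: (@measurable_fun_cvg _ (borel_rV R d) R setT (fun n (x : borel_rV R d) =>
  n.+1%:R * (grad h ((x : 'rV_d) + (1 / n.+1%:R) *: delta_mx ord0 i) ord0 j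
             - grad h x ord0 j))).
  move=> n; apply: measurable_funM => //.
  apply: measurable_funB; last exact: continuous_measurable_rV.
  apply: (continuous_measurable_rV
    (g := fun x => grad h (x + (1 / n.+1%:R) *: delta_mx ord0 i) ord0 j)) => x.
  exact: (continuous_comp (@continuous_addr_rV _ _ _ x) (gc j _)).
by move=> x _; have := @hess_cvg _ _ _ hd x (delta_mx ord0 i) j; rewrite delta_mulmx.
Qed.

Context (F : Z -> 'rV[R]_d -> R) (F_diff : forall z, twice_differentiable (F z)).
Hypothesis F_meas : forall x i, measurable_fun setT (fun z => grad (F z) x ord0 i).

Let grad_coord_continuous z i : continuous (fun x => grad (F z) x ord0 i).
Proof.
move=> x; exact: (continuous_comp (@continuous_grad _ _ _ (F_diff z) x)
  (@coord_continuous _ _ _ ord0 i _)).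
Qed.

Lemma measurable_grad_joint : measurable_fun setT
  (fun p : Z * borel_rV R d => grad (F p.1) p.2 : borel_rV R d).
Proof.
apply: measurable_rV => i.
exact: (measurable_caratheodory (phi := fun z x => grad (F z) x ord0 i)).
Qed.

Lemma measurable_hess_joint i j : measurable_fun setT
  (fun p : Z * borel_rV R d => hess (F p.1) p.2 i j).
Proof.
apply: (@measurable_fun_cvg _ (Z * borel_rV R d)%type R setT (fun n p =>
  n.+1%:R * (grad (F p.1) ((p.2 : 'rV_d) + (1 / n.+1%:R) *: delta_mx ord0 i) ord0 j
             - grad (F p.1) p.2 ord0 j))).
  move=> n; apply: measurable_funM => //; apply: measurable_funB.
    apply: (measurable_caratheodory (phi := fun z x =>
      grad (F z) (x + (1 / n.+1%:R) *: delta_mx ord0 i) ord0 j)) => [x|z x].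
      exact: F_meas.
    exact: (continuous_comp (@continuous_addr_rV _ _ _ x)
      (@grad_coord_continuous z j _)).
  exact: (measurable_caratheodory (phi := fun z x => grad (F z) x ord0 j)).
move=> p _.
by have := @hess_cvg _ _ _ (F_diff p.1) p.2 (delta_mx ord0 i) j; rewrite delta_mulmx.
Qed.

End measurable_derivatives.

Lemma integral_uniform01 {R : realType} (h : R -> \bar R) :
  measurable_fun setT h ->
  (\int[uniform_prob (@ltr01 R)]_t h t =
   \int[lebesgue_measure]_(t in `[0%R, 1%R]) h t)%E.
Proof.
move=> mh; rewrite integralE [RHS]integralE.
rewrite !integral_uniform//; [|exact: measurable_funeneg|exact: measurable_funepos].
by rewrite subr0 invr1 !mul1e.
Qed.

Lemma integral_uniform01_le {R : realType} (h : R -> R) (B : R) :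
  measurable_fun setT h -> (forall s, 0 <= h s) ->
  (forall s, 0 <= s <= 1 -> h s <= B) ->
  (\int[uniform_prob (@ltr01 R)]_s (h s)%:E <= B%:E)%E.
Proof.
move=> mh h0 hB; rewrite integral_uniform01; last exact/measurable_EFinP.
have : (\int[lebesgue_measure]_(t in `[0%R, 1%R]) (h t)%:E <=
    \int[lebesgue_measure]_(t in `[0%R, 1%R]) (cst B%:E) t)%E.
  apply: ge0_le_integral => //=.
  - by move=> t _; rewrite lee_fin.
  - by apply/measurable_EFinP; exact: measurable_funTS.
by rewrite integral_cst//= lebesgue_measure_itv/= lte_fin ltr01 sube0 mule1.
Qed.

Section sub_sigma_algebra.
Context {dT : measure_display} {T : measurableType dT} {R : realType}.
Context (P : probability T R) {I : choiceType} (S : I -> set (set T)).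
Hypothesis S_meas : forall i, S i `<=` measurable.
Hypothesis S_setT : forall i, S i setT.
Hypothesis S_setI : forall i, setI_closed (S i).
Hypothesis S_indep : mutually_independent P S.

(** The points of [T] with the sigma-algebra generated by the sources in [J]: being determined by
    these sources becomes ordinary measurability of a map on [sub_space J]. *)
Definition sub_space (J : set I) : measurableType _ :=
  g_sigma_algebraType (\bigcup_(i in J) S i).

Lemma sub_space_measurable (J : set I) (A : set T) :
  measurable (A : set (sub_space J)) -> measurable A.
Proof.
apply: smallest_sub; first exact: sigma_algebra_measurable.
by move=> B [i _ SB]; exact: S_meas SB.
Qed.

Lemma measurable_sub_space {dU : measure_display} {U : measurableType dU}
    (J : set I) (X : T -> U) :
  measurable_fun setT (X : sub_space J -> U) -> measurable_fun setT X.
Proof. by move=> mX _ B mB; apply: (@sub_space_measurable J); exact: mX. Qed.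

Lemma measurable_sub_spaceS {dU : measure_display} {U : measurableType dU}
    (J J' : set I) (X : T -> U) : J `<=` J' ->
  measurable_fun setT (X : sub_space J -> U) ->
  measurable_fun setT (X : sub_space J' -> U).
Proof.
move=> JJ mX _ B mB; have := mX measurableT B mB.
by apply: sub_sigma_algebra2; exact: bigcup_subset.
Qed.

Lemma measurable_source {dU : measure_display} {U : measurableType dU}
    (J : set I) (j : I) (X : T -> U) : J j ->
  preimage_set_system setT X measurable `<=` S j ->
  measurable_fun setT (X : sub_space J -> U).
Proof.
move=> Jj XS _ B mB; apply: sub_sigma_algebra; exists j => //.
by apply: XS; exists B.
Qed.

Context {dV : measure_display} {V : measurableType dV} (mu : probability V R).
Context (J : set I) (j : I) (Y : {RV P >-> V}).
Hypotheses (Jj : ~ J j) (Y_law : has_law Y mu).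
Hypothesis YS : preimage_set_system setT Y measurable `<=` S j.

(** The identity into [sub_space J] is a random variable carrying the whole past at once, so the
    lemmas on independent pairs apply to it and [Y]. *)
Let idJ : {mfun T >-> sub_space J} := HB.pack (fun t : T => t : sub_space J)
  (isMeasurableFun.Build _ _ _ _ _
    (fun _ (B : set (sub_space J)) mB =>
       measurableI _ _ (@measurableT _ T) (sub_space_measurable mB))).

Let idJ_indep A B : measurable A -> measurable B ->
  P (idJ @^-1` A `&` Y @^-1` B) = (P (idJ @^-1` A) * mu B)%E.
Proof.
move=> mA mB; rewrite -Y_law//.
apply: (mutually_independent_generated S_meas S_setT S_setI S_indep Jj) => //.
by apply: YS; exists B => //; rewrite setTI.
Qed.

(** Takes the place of conditioning: the past is frozen at [t] and the fresh variable is integrated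
    out against its law. *)
Lemma ge0_integral_fresh (h : T -> V -> R) :
  measurable_fun setT (fun p : sub_space J * V => h p.1 p.2) ->
  (forall t v, 0 <= h t v) ->
  (\int[P]_t (h t (Y t))%:E = \int[P]_t \int[mu]_v (h t v)%:E)%E.
Proof.
move=> mh h0.
have := @ge0_integral_indep _ _ _ _ _ _ _ P idJ Y mu idJ_indep
  (fun p => (h p.1 p.2)%:E).
by apply => [|p]; [exact/measurable_EFinP|rewrite lee_fin].
Qed.

Lemma has_mean_fresh0 (h : T -> V -> R) :
  measurable_fun setT (fun p : sub_space J * V => h p.1 p.2) ->
  (exists r, has_mean P (fun t => h t (Y t)) r) ->
  (forall t, \int[mu]_v (h t v)%:E = 0)%E -> has_mean P (fun t => h t (Y t)) 0.
Proof.
move=> mh [r [ih _]] h0; apply: has_mean_integral => //.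
have := @integral_indep0 _ _ _ _ _ _ _ P idJ Y mu idJ_indep
  (fun p => (h p.1 p.2)%:E).
by apply => //; exact/measurable_EFinP.
Qed.

Lemma has_mean_fresh (h : T -> V -> R) (G : T -> R) (r : R) :
  measurable_fun setT (fun p : sub_space J * V => h p.1 p.2) ->
  (forall t v, 0 <= h t v) -> has_mean P G r ->
  (forall t, \int[mu]_v (h t v)%:E <= (G t)%:E)%E ->
  exists2 s, has_mean P (fun t => h t (Y t)) s & s <= r.
Proof.
move=> mh h0 hG hle; apply: has_mean_exists => //.
  have mid : measurable_fun setT (fun t : T => (t : sub_space J, Y t)).
    by apply/measurable_fun_pairP; split; [exact: (@measurable_funPT _ _ _ _ idJ)|].
  exact: (measurableT_comp mh mid).
rewrite ge0_integral_fresh// -(integral_has_mean hG).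
apply: ge0_le_integral => //=.
- by move=> t _; apply: integral_ge0 => v _; rewrite lee_fin.
- have := measurable_fun_fubini_tonelli_F (m2 := mu) (fun p : sub_space J * V => (h p.1 p.2)%:E).
  move=> mF; apply: (measurable_sub_space (mF _ _)).
    exact/measurable_EFinP.
  by move=> p; rewrite lee_fin.
- by apply/measurable_EFinP; exact: has_mean_measurable hG.
Qed.

End sub_sigma_algebra.

(** * The error recursion *)

Section algorithm.
Context {R : realType} {d : nat} {dT dZ : measure_display}
  {T : measurableType dT} {Z : measurableType dZ}.
Context (P : probability T R) (D : probability Z R).
Context (N : 'rV[R]_d -> R) (N_norm : is_norm N).
Context (rho_lo rho_hi theta_lo : R) (rho_lo_gt0 : 0 < rho_lo)
  (rho_hi_gt0 : 0 < rho_hi) (theta_lo_gt0 : 0 < theta_lo).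
Hypothesis rho_loP : forall u, rho_lo * norm2 u <= dual_norm N u.
Hypothesis rho_hiP : forall u, dual_norm N u <= rho_hi * norm2 u.
Hypothesis theta_loP : forall u, theta_lo * norm2 u <= N u.
Context (F : Z -> 'rV[R]_d -> R) (f : 'rV[R]_d -> R)
  (F_diff : forall z, twice_differentiable (F z)) (f_diff : twice_differentiable f).
Context (sigma_g sigma_H L0 L1 : R) (sigma_H_ge0 : 0 <= sigma_H)
  (L0_ge0 : 0 <= L0) (L1_gt0 : 0 < L1).
Hypothesis A1 : stochastic_gradient_hessian D F f sigma_g sigma_H.
Hypothesis A3 : symmetric_L0L1_lipschitz N L0 L1 f.
Context (K : nat) (alpha eta : R) (alpha_gt0 : 0 < alpha) (alpha_le1 : alpha <= 1)
  (eta_ge0 : 0 <= eta) (eta_small : L1 * eta <= 80^-1).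
Context (xi : nat -> {RV P >-> Z}) (b : nat -> {RV P >-> R})
  (x0 : 'rV[R]_d) (m0 : T -> 'rV[R]_d).
Hypothesis m0_meas : measurable_fun setT (m0 : T -> borel_rV R d).
Hypothesis xi_law : forall k, has_law (xi k) D.
Hypothesis b_law : forall k, has_law (b k) (uniform_prob (@ltr01 R)).
Hypothesis indep : mutually_independent P (source_sigma_algebra m0 xi b).
Context (lmo : nat -> 'rV[R]_d -> 'rV[R]_d).
Hypothesis lmo_meas : forall k, (k <= K)%N ->
  measurable_fun setT (lmo k : borel_rV R d -> borel_rV R d).
Hypothesis lmoP : forall k u, (k <= K)%N -> is_lmo N eta u (lmo k u).
Context (x xhat m : nat -> T -> 'rV[R]_d).
Hypothesis x_init : forall t, x 0%N t = x0.
Hypothesis m_init : forall t, m 0%N t = m0 t.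
Hypothesis x_step : forall k t, (k <= K)%N -> x k.+1 t = x k t + lmo k (m k t).
Hypothesis xhat_step : forall k t, (k <= K)%N ->
  xhat k.+1 t = b k t *: x k.+1 t + (1 - b k t) *: x k t.
Hypothesis m_step : forall k t, (k <= K)%N ->
  m k.+1 t =
    (1 - alpha) *:
      (m k t + (x k.+1 t - x k t) *m hess (F (xi k t)) (xhat k.+1 t))
    + alpha *: grad (F (xi k t)) (x k.+1 t).

Local Notation dn := (dual_norm N).
Local Notation g := (fun u => dn (grad f u)).
Local Notation src := (source_sigma_algebra m0 xi b).

Let dnD := dual_normD N_norm theta_lo_gt0 theta_loP.
Let dnZ := dual_normZ_le N_norm theta_lo_gt0 theta_loP.
Let dnN := dual_normN N_norm theta_lo_gt0 theta_loP.
Let dn_ge0 := dual_norm_ge0 N_norm theta_lo_gt0 theta_loP.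
Let dn_continuous := continuous_dual_norm N_norm theta_lo_gt0 theta_loP rho_hiP.
Let beta := 1 - alpha.
Let beta01 : 0 <= beta <= 1. Proof. by rewrite subr_ge0 alpha_le1 gerBl ltW. Qed.

(** * Sources of randomness and filtration *)

Let src_meas i : src i `<=` measurable.
Proof.
by case: i => [[k|k]|] _ [B mB <-] /=; [exact: measurable_funPT|
  exact: measurable_funPT|exact: m0_meas].
Qed.

Let src_setT i : src i setT.
Proof.
by case: i => [[k|k]|] /=; exists setT => //; rewrite preimage_setT setTI.
Qed.

Let src_setI i : setI_closed (src i).
Proof.
by case: i => [[k|k]|] _ _ [A mA <-] [B mB <-] /=; exists (A `&` B);
  rewrite ?preimage_setI ?setTI//; exact: measurableI.
Qed.

(* The step goes from past k to mid k by revealing b k, then to past k.+1 by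
   revealing xi k. *)
Let past k : set (option (nat + nat)) := [set i |
  match i with
  | None => True | Some (inl j) => (j < k)%N | Some (inr j) => (j < k)%N
  end].
Let mid k : set (option (nat + nat)) := past k `|` [set Some (inr k)].

Local Notation before k := (sub_space src (past k)).
Local Notation between k := (sub_space src (mid k)).

Let pastS k : past k `<=` past k.+1.
Proof. by move=> [[j|j]|] //=; exact: leqW. Qed.

Let past_mid k : past k `<=` mid k. Proof. by move=> i; left. Qed.

Let past_xi k : ~ past k (Some (inl k)). Proof. by rewrite /past/= ltnn. Qed.
Let past_b k : ~ past k (Some (inr k)). Proof. by rewrite /past/= ltnn. Qed.
Let mid_xi k : ~ mid k (Some (inl k)). Proof. by move=> [/past_xi|]. Qed.

Let step k t := lmo k (m k t).

Let N_step k t : (k <= K)%N -> N (step k t) <= eta.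
Proof. by move=> kK; case: (lmoP (m k t) kK). Qed.

Let step_small k t : (k <= K)%N -> L1 * N (step k t) <= 80^-1.
Proof.
by move=> kK; rewrite (le_trans _ eta_small)// ler_pM2l// N_step.
Qed.

Let xS k t : (k <= K)%N -> x k.+1 t = x k t + step k t.
Proof. exact: x_step. Qed.

Let xhatS k t : (k <= K)%N -> xhat k.+1 t = x k t + b k t *: step k t.
Proof.
move=> kK; rewrite xhat_step// xS// scalerDr scalerBl scale1r.
by rewrite (addrC (_ *: x k t)) -addrA subrKC addrC.
Qed.

(** * Measurability of the oracle and adaptedness of the iterates *)

Let F_grad_meas u i : measurable_fun setT (fun z => grad (F z) u ord0 i).
Proof. exact: has_mean_measurable (grad_unbiased A1 u i). Qed.

Let grad_meas {d1} {U : measurableType d1} (X : U -> borel_rV R d) :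
  measurable_fun setT X -> measurable_fun setT (fun t => grad f (X t) : borel_rV R d).
Proof.
move=> mX; apply: (measurableT_comp (f := grad f : borel_rV R d -> borel_rV R d)) => //.
by apply: continuous_measurable_rV_rV; exact: continuous_grad.
Qed.

Let hess_meas {d1} {U : measurableType d1} (X : U -> borel_rV R d) i j :
  measurable_fun setT X -> measurable_fun setT (fun t => hess f (X t) i j).
Proof.
move=> mX.
by apply: (measurableT_comp (f := fun u : borel_rV R d => hess f u i j)) => //;
  exact: measurable_hess.
Qed.

Let F_grad_joint_meas {d1} {U : measurableType d1} (Y : U -> Z) (X : U -> borel_rV R d) :
  measurable_fun setT Y -> measurable_fun setT X ->
  measurable_fun setT (fun t => grad (F (Y t)) (X t) : borel_rV R d).
Proof.
move=> mY mX.
exact: (measurableT_comp (measurable_grad_joint F_diff F_grad_meas)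
  (measurable_fun_pair mY mX)).
Qed.

Let F_hess_joint_meas {d1} {U : measurableType d1} (Y : U -> Z) (X : U -> borel_rV R d)
    i j : measurable_fun setT Y -> measurable_fun setT X ->
  measurable_fun setT (fun t => hess (F (Y t)) (X t) i j).
Proof.
move=> mY mX.
exact: (measurableT_comp (measurable_hess_joint F_diff F_grad_meas i j)
  (measurable_fun_pair mY mX)).
Qed.

Let dn_meas {d1} {U : measurableType d1} (X : U -> borel_rV R d) :
  measurable_fun setT X -> measurable_fun setT (fun t => dn (X t)).
Proof.
move=> mX; apply: (measurableT_comp (f := dn : borel_rV R d -> R)) => //.
exact: continuous_measurable_rV.
Qed.

Let step_meas k {d1} {U : measurableType d1} (mU : U -> T) : (k <= K)%N ->
  measurable_fun setT (fun u => m k (mU u) : borel_rV R d) ->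
  measurable_fun setT (fun u => step k (mU u) : borel_rV R d).
Proof. by move=> kK mm; exact: (measurableT_comp (lmo_meas kK) mm). Qed.

(** By induction along the recursion, each update of which draws only on [xi k] and [b k]. Since a
    step depends on [m k] alone, [x k.+1] is already fixed before these are revealed; this is why it
    appears below as [x k t + step k t]. *)
Let adapted k : (k <= K.+1)%N ->
  measurable_fun setT (x k : before k -> borel_rV R d) /\
  measurable_fun setT (m k : before k -> borel_rV R d).
Proof.
elim: k => [_|k ih kK].
  split; first by rewrite (funext x_init); exact: measurable_cst.
  rewrite (funext m_init).
  exact: (@measurable_source _ _ _ src _ _ _ None).
have [mx mm] := ih (ltnW kK).
have mx' := measurable_sub_spaceS (@pastS k) mx.
have mm' := measurable_sub_spaceS (@pastS k) mm.
have mst : measurable_fun setT (step k : before k.+1 -> borel_rV R d).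
  exact: (@step_meas k _ (before k.+1) id).
have mx1 : measurable_fun setT (x k.+1 : before k.+1 -> borel_rV R d).
  rewrite (funext (fun t => @xS k t kK)).
  exact: measurable_rVD.
have mxi : measurable_fun setT (xi k : before k.+1 -> Z).
  by apply: (@measurable_source _ _ _ src _ _ _ (Some (inl k))) => /=.
have mb : measurable_fun setT (b k : before k.+1 -> R).
  by apply: (@measurable_source _ _ _ src _ _ _ (Some (inr k))) => /=.
have mxhat : measurable_fun setT (xhat k.+1 : before k.+1 -> borel_rV R d).
  rewrite (funext (fun t => @xhatS k t kK)).
  by apply: measurable_rVD => //; exact: measurable_rVZ.
split => //; rewrite (funext (fun t => m_step t kK)).
apply: measurable_rVD; apply: measurable_rVZ => //; last exact: F_grad_joint_meas.
apply: measurable_rVD => //; apply: measurable_rV_mulmx; first exact: measurable_rVB.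
by move=> i j; exact: F_hess_joint_meas.
Qed.

Let x_meas k : (k <= K.+1)%N -> measurable_fun setT (x k : T -> borel_rV R d).
Proof.
by move=> kK; apply: (measurable_sub_space src_meas (J := past k)); case: (adapted kK).
Qed.

Let m_meas k : (k <= K.+1)%N -> measurable_fun setT (m k : T -> borel_rV R d).
Proof.
by move=> kK; apply: (measurable_sub_space src_meas (J := past k)); case: (adapted kK).
Qed.

(** * Bias, sampling noise and the cut of the bias *)

Let g_ge0 u : 0 <= g u. Proof. exact: dn_ge0. Qed.
Let L1_ge0 : 0 <= L1. Proof. exact: ltW. Qed.
Let c1 : R := 80 / 79.
Let c1_ge0 : 0 <= c1. Proof. by rewrite divr_ge0. Qed.
Let slope_ge0 u : 0 <= L0 + L1 * g u.
Proof. exact: addr_ge0 L0_ge0 (mulr_ge0 L1_ge0 (g_ge0 _)). Qed.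

(* Given the past, bias has mean zero over the uniform variable, curv over
   the sample through the Hessian, and grad_noise over the sample. *)
Let bias k t (s : R) : 'rV[R]_d :=
  grad f (x k t) - grad f (x k t + step k t)
  + step k t *m hess f (x k t + s *: step k t).
Let curv k t z : 'rV[R]_d :=
  step k t *m (hess (F z) (x k t + b k t *: step k t)
               - hess f (x k t + b k t *: step k t)).
Let grad_noise k t z : 'rV[R]_d :=
  grad (F z) (x k t + step k t) - grad f (x k t + step k t).

(* The bias is of order L0 + L1 * g (x k). The past-measurable weight w splits
   it into a centred part of order L0, whose second moment is controlled, and a
   part of order L1 * g (x k), which is summed by the triangle inequality. *)
Let w k t : R := if L1 * g (x k t) <= L0 then 1 else 0.

Let bias_le k t s : (k <= K)%N -> 0 <= s <= 1 ->
  dn (bias k t s) <= 2 * c1 * (L0 + L1 * g (x k t)) * eta.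
Proof.
move=> kK s01; rewrite (le_trans (dnD _ _))//.
have h1 := grad_step N_norm theta_lo_gt0 theta_loP rho_hiP f_diff L0_ge0 L1_gt0 A3
  (x k t) (step_small t kK).
have h2 := hess_segment N_norm theta_lo_gt0 theta_loP rho_hiP f_diff L0_ge0 L1_gt0 A3
  (x k t) (step_small t kK) s01.
have h3 : 80 / 79 * (L0 + L1 * g (x k t)) * N (step k t) <=
    c1 * (L0 + L1 * g (x k t)) * eta.
  by rewrite ler_wpM2l ?N_step// mulr_ge0.
have -> : 2 * c1 * (L0 + L1 * g (x k t)) * eta =
    c1 * (L0 + L1 * g (x k t)) * eta + c1 * (L0 + L1 * g (x k t)) * eta by ring.
apply: lerD; last exact: le_trans h2 h3.
by move: (le_trans h1 h3); rewrite -opprB dnN.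
Qed.

Let w01 k t : 0 <= w k t <= 1.
Proof. by rewrite /w; case: ifP; rewrite ?lexx ?ler01. Qed.

Let wM k t : w k t * (L0 + L1 * g (x k t)) <= 2 * L0.
Proof.
by rewrite /w; case: ifP => h; rewrite ?mul0r ?mulr_ge0// mul1r mulr_natl mulr2n lerD2l.
Qed.

Let onem_wM k t : (1 - w k t) * (L0 + L1 * g (x k t)) <= 2 * (L1 * g (x k t)).
Proof.
rewrite /w; case: ifPn => h; rewrite ?subrr ?subr0 ?mul0r ?mul1r.
  by rewrite mulr_ge0// mulr_ge0.
by rewrite mulr_natl mulr2n lerD2r ltW// ltNge.
Qed.

(** The 4 is the 2 of [bias_le], one for the gradient increment and one for the Hessian, times the 2
    of [wM]. Dividing by [rho_lo] passes to the Euclidean norm, where orthogonality is used. *)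
Let bias1_le k t s : (k <= K)%N -> 0 <= s <= 1 ->
  norm2 (w k t *: bias k t s) <= 4 * c1 * L0 * eta / rho_lo.
Proof.
move=> kK s01; rewrite ler_pdivlMr// mulrC (le_trans (rho_loP _))//.
have /andP[w0 _] := w01 k t.
rewrite (le_trans (dnZ _ _))// ger0_norm//.
rewrite (le_trans (ler_wpM2l w0 (bias_le t kK s01)))//.
have -> : w k t * (2 * c1 * (L0 + L1 * g (x k t)) * eta) =
  2 * c1 * eta * (w k t * (L0 + L1 * g (x k t))) by ring.
have -> : 4 * c1 * L0 * eta = 2 * c1 * eta * (2 * L0) by ring.
by rewrite ler_wpM2l ?mulr_ge0.
Qed.

(** This part is summed by the triangle inequality, so it stays in the dual norm and loses no
    equivalence constant. *)
Let bias2_le k t s : (k <= K)%N -> 0 <= s <= 1 ->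
  dn ((1 - w k t) *: bias k t s) <= 4 * c1 * L1 * eta * g (x k t).
Proof.
move=> kK s01; have /andP[_ w1] := w01 k t.
have w1' : 0 <= 1 - w k t by rewrite subr_ge0.
rewrite (le_trans (dnZ _ _))// ger0_norm//.
rewrite (le_trans (ler_wpM2l w1' (bias_le t kK s01)))//.
have -> : (1 - w k t) * (2 * c1 * (L0 + L1 * g (x k t)) * eta) =
  2 * c1 * eta * ((1 - w k t) * (L0 + L1 * g (x k t))) by ring.
have -> : 4 * c1 * L1 * eta * g (x k t) = 2 * c1 * eta * (2 * (L1 * g (x k t))) by ring.
by rewrite ler_wpM2l ?mulr_ge0.
Qed.

(** The error recursion driven by its centred inputs only and started at 0: the initial error is
    controlled in first moment only and is left to [Rest]. *)
Let Mart : nat -> T -> 'rV[R]_d := fix Mart k := match k with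
  | 0%N => fun=> 0
  | k.+1 => fun t =>
      beta *: (Mart k t + w k t *: bias k t (b k t) + curv k t (xi k t))
      + alpha *: grad_noise k t (xi k t)
  end.

Let err k t := m k t - grad f (x k t).
Let Rest k t := err k t - Mart k t.

Let errS k t : (k <= K)%N -> err k.+1 t =
  beta *: (err k t + bias k t (b k t) + curv k t (xi k t))
  + alpha *: grad_noise k t (xi k t).
Proof.
move=> kK; rewrite /err m_step// xhatS// xS// (addrAC (x k t)) subrr add0r.
rewrite /bias /curv /grad_noise mulmxBr.
have alg (v g0 g1 hz hf G : 'rV[R]_d) :
    (1 - alpha) *: (v + hz) + alpha *: G - g1 =
    beta *: (v - g0 + (g0 - g1 + hf) + (hz - hf)) + alpha *: (G - g1).
  by rewrite /beta; apply/rowP => i; rewrite !mxE; ring.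
exact: alg.
Qed.

Let RestS k t : (k <= K)%N ->
  Rest k.+1 t = beta *: (Rest k t + (1 - w k t) *: bias k t (b k t)).
Proof.
move=> kK; rewrite /Rest errS//=.
have alg (e0 M0 u v r : 'rV[R]_d) (a : R) :
    beta *: (e0 + u + v) + alpha *: r - (beta *: (M0 + a *: u + v) + alpha *: r) =
    beta *: (e0 - M0 + (1 - a) *: u).
  by apply/rowP => i; rewrite !mxE; ring.
exact: alg.
Qed.

(** * Measurability of the inputs of the recursion *)

Section process_measurable.
Context {d1 : measure_display} {U : measurableType d1} (pt : U -> T) (k : nat).
Hypotheses (kK : (k <= K)%N)
  (mx : measurable_fun setT (fun u => x k (pt u) : borel_rV R d))
  (mm : measurable_fun setT (fun u => m k (pt u) : borel_rV R d)).

Let mstep : measurable_fun setT (fun u => step k (pt u) : borel_rV R d).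
Proof. exact: step_meas. Qed.

Let mnext : measurable_fun setT (fun u => x k (pt u) + step k (pt u) : borel_rV R d).
Proof. exact: measurable_rVD. Qed.

Let w_meas : measurable_fun setT (fun u => w k (pt u)).
Proof.
apply: measurable_fun_ifT => //; apply: measurable_fun_ler => //.
by apply: measurable_funM => //; apply: dn_meas; exact: grad_meas.
Qed.

Let bias_meas (s : U -> R) : measurable_fun setT s ->
  measurable_fun setT (fun u => bias k (pt u) (s u) : borel_rV R d).
Proof.
move=> ms; apply: measurable_rVD.
  by apply: measurable_rVB; exact: grad_meas.
apply: measurable_rV_mulmx => // i j; apply: hess_meas.
by apply: measurable_rVD => //; exact: measurable_rVZ.
Qed.

(** The parametrisation [pt : U -> T] lets one proof serve on [T], on the sub-sigma-algebras and on
    their products with the space of a fresh variable. *)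
Lemma bias1_meas (s : U -> R) : measurable_fun setT s ->
  measurable_fun setT (fun u => w k (pt u) *: bias k (pt u) (s u) : borel_rV R d).
Proof. by move=> ms; apply: measurable_rVZ => //; exact: bias_meas. Qed.

Lemma bias2_meas (s : U -> R) : measurable_fun setT s ->
  measurable_fun setT (fun u => (1 - w k (pt u)) *: bias k (pt u) (s u) : borel_rV R d).
Proof.
by move=> ms; apply: measurable_rVZ; [exact: measurable_funB|exact: bias_meas].
Qed.

Lemma curv_meas (z : U -> Z) : measurable_fun setT (fun u => b k (pt u)) ->
  measurable_fun setT z ->
  measurable_fun setT (fun u => curv k (pt u) (z u) : borel_rV R d).
Proof.
move=> mb mz; apply: measurable_rV_mulmx => // i j.
have entryB (A B : 'M[R]_d) : (A - B) i j = A i j - B i j by rewrite !mxE.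
under eq_fun do rewrite entryB.
have mhat : measurable_fun setT
    (fun u => x k (pt u) + b k (pt u) *: step k (pt u) : borel_rV R d).
  by apply: measurable_rVD => //; exact: measurable_rVZ.
by apply: measurable_funB; [exact: F_hess_joint_meas|exact: hess_meas].
Qed.

Lemma grad_noise_meas (z : U -> Z) : measurable_fun setT z ->
  measurable_fun setT (fun u => grad_noise k (pt u) (z u) : borel_rV R d).
Proof.
by move=> mz; apply: measurable_rVB; [exact: F_grad_joint_meas|exact: grad_meas].
Qed.

End process_measurable.
Let x_adapted k : (k <= K.+1)%N -> measurable_fun setT (x k : before k -> borel_rV R d).
Proof. by case/adapted. Qed.
Let m_adapted k : (k <= K.+1)%N -> measurable_fun setT (m k : before k -> borel_rV R d).
Proof. by case/adapted. Qed.

Let x_mid k : (k <= K)%N -> measurable_fun setT (x k : between k -> borel_rV R d).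
Proof. move=> kK; exact: measurable_sub_spaceS (@past_mid k) (x_adapted (leqW kK)). Qed.
Let m_mid k : (k <= K)%N -> measurable_fun setT (m k : between k -> borel_rV R d).
Proof. move=> kK; exact: measurable_sub_spaceS (@past_mid k) (m_adapted (leqW kK)). Qed.
Let b_mid k : measurable_fun setT (b k : between k -> R).
Proof. by apply: (@measurable_source _ _ _ src _ _ _ (Some (inr k))) => //; right. Qed.

Let Mart_adapted k : (k <= K.+1)%N ->
  measurable_fun setT (Mart k : before k -> borel_rV R d).
Proof.
elim: k => [_|k ih kK]; first exact: measurable_cst.
have mM := measurable_sub_spaceS (@pastS k) (ih (ltnW kK)).
have mx := measurable_sub_spaceS (@pastS k) (x_adapted (ltnW kK)).
have mm := measurable_sub_spaceS (@pastS k) (m_adapted (ltnW kK)).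
have mxi : measurable_fun setT (xi k : before k.+1 -> Z).
  by apply: (@measurable_source _ _ _ src _ _ _ (Some (inl k))) => /=.
have mb : measurable_fun setT (b k : before k.+1 -> R).
  by apply: (@measurable_source _ _ _ src _ _ _ (Some (inr k))) => /=.
apply: measurable_rVD; apply: measurable_rVZ => //.
  apply: measurable_rVD; first apply: measurable_rVD => //.
    exact: (@bias1_meas _ (before k.+1) id).
  exact: (@curv_meas _ (before k.+1) id).
exact: (@grad_noise_meas _ (before k.+1) id).
Qed.

Let Mart_meas k : (k <= K.+1)%N -> measurable_fun setT (Mart k : T -> borel_rV R d).
Proof.
move=> kK.
exact: (measurable_sub_space src_meas (J := past k) (Mart_adapted kK)).
Qed.

Let on_before k {dV} {V : measurableType dV} (X : T -> borel_rV R d) :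
  measurable_fun setT (X : before k -> borel_rV R d) ->
  measurable_fun setT (fun p : before k * V => X p.1 : borel_rV R d).
Proof. move=> mX; exact: measurableT_comp mX measurable_fst. Qed.

Let on_mid k {dV} {V : measurableType dV} (X : T -> borel_rV R d) :
  measurable_fun setT (X : between k -> borel_rV R d) ->
  measurable_fun setT (fun p : between k * V => X p.1 : borel_rV R d).
Proof. move=> mX; exact: measurableT_comp mX measurable_fst. Qed.

Let bias1_before k : (k <= K)%N -> measurable_fun setT
  (fun p : before k * measurableTypeR R => w k p.1 *: bias k p.1 p.2 : borel_rV R d).
Proof.
move=> kK; apply: (@bias1_meas _ (before k * measurableTypeR R)%type fst) => //.
- exact: on_before (x_adapted (leqW kK)).
- exact: on_before (m_adapted (leqW kK)).
Qed.

Let bias2_before k : (k <= K)%N -> measurable_fun setT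
  (fun p : before k * measurableTypeR R => (1 - w k p.1) *: bias k p.1 p.2 : borel_rV R d).
Proof.
move=> kK; apply: (@bias2_meas _ (before k * measurableTypeR R)%type fst) => //.
- exact: on_before (x_adapted (leqW kK)).
- exact: on_before (m_adapted (leqW kK)).
Qed.

Let curv_mid k : (k <= K)%N -> measurable_fun setT
  (fun p : between k * Z => curv k p.1 p.2 : borel_rV R d).
Proof.
move=> kK; apply: (@curv_meas _ (between k * Z)%type fst) => //.
- exact: on_mid (x_mid kK).
- exact: on_mid (m_mid kK).
- exact: measurableT_comp (@b_mid k) measurable_fst.
Qed.

Let grad_noise_mid k : (k <= K)%N -> measurable_fun setT
  (fun p : between k * Z => grad_noise k p.1 p.2 : borel_rV R d).
Proof.
move=> kK; apply: (@grad_noise_meas _ (between k * Z)%type fst) => //.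
- exact: on_mid (x_mid kK).
- exact: on_mid (m_mid kK).
Qed.

(* The Borel sigma-algebra of R carries a second display, which is that of
   uniform_prob. *)
Let b_borel k : measurable_fun setT (b k : T -> measurableTypeR R).
Proof. exact: (@measurable_funPT _ _ _ _ (b k)). Qed.
Let b' k : {RV P >-> measurableTypeR R} :=
  HB.pack (b k : T -> measurableTypeR R) (isMeasurableFun.Build _ _ _ _ _ (@b_borel k)).
Let b'_law k : has_law (b' k) (uniform_prob (@ltr01 R)).
Proof. by move=> A mA; exact: b_law. Qed.
Let b'_src k : preimage_set_system setT (b' k) measurable `<=` src (Some (inr k)).
Proof. by []. Qed.

Let freshD k := @has_mean_fresh _ _ _ P _ src src_meas src_setT src_setI indep
  _ _ D (mid k) (Some (inl k)) (xi k) (@mid_xi k) (xi_law k)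
  (fun A hA => hA).
Let freshU k := @has_mean_fresh _ _ _ P _ src src_meas src_setT src_setI indep
  _ _ (uniform_prob (@ltr01 R)) (past k) (Some (inr k)) (b' k) (@past_b k) (@b'_law k)
  (@b'_src k).
Let freshD0 k := @has_mean_fresh0 _ _ _ P _ src src_meas src_setT src_setI indep
  _ _ D (mid k) (Some (inl k)) (xi k) (@mid_xi k) (xi_law k)
  (fun A hA => hA).
Let freshU0 k := @has_mean_fresh0 _ _ _ P _ src src_meas src_setT src_setI indep
  _ _ (uniform_prob (@ltr01 R)) (past k) (Some (inr k)) (b' k) (@past_b k) (@b'_law k)
  (@b'_src k).

(** * Second moment of the martingale *)

Let cA : R := 4 * c1 * L0 * eta / rho_lo.
Let cB : R := sigma_H * eta / theta_lo.

Let cA_ge0 : 0 <= cA.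
Proof. by rewrite divr_ge0 ?(ltW rho_lo_gt0)// !mulr_ge0. Qed.
Let cB_ge0 : 0 <= cB.
Proof. by rewrite divr_ge0 ?(ltW theta_lo_gt0)// mulr_ge0. Qed.

Let norm2_step k t : (k <= K)%N -> norm2 (step k t) <= eta / theta_lo.
Proof.
by move=> kK; rewrite ler_pdivlMr// mulrC (le_trans (theta_loP _))// N_step.
Qed.

Let slice_meas {dU dV} {U : measurableType dU} {V : measurableType dV} (h : U * V -> R) u :
  measurable_fun setT h -> measurable_fun setT (fun v => h (u, v)).
Proof. by move=> mh; exact: (measurableT_comp mh (measurable_pair1 u)). Qed.

(** [b k t] lies in [[0, 1]] only almost surely, so [bias1_le] is applied under the uniform law and
    not for each [t]. *)
Let bias1_moment k : (k <= K)%N ->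
  exists2 s, has_mean P (fun t => norm2 (w k t *: bias k t (b k t)) ^+ 2) s &
    s <= cA ^+ 2.
Proof.
move=> kK.
have mh := measurable_sqr_norm2 (bias1_before kK).
apply: (@freshU k (fun t s => norm2 (w k t *: bias k t s) ^+ 2) (cst (cA ^+ 2))).
- exact: mh.
- by move=> t s; exact: sqr_ge0.
- exact: has_mean_cst.
- move=> t; apply: integral_uniform01_le => [||s s01].
  + exact: (slice_meas (t : before k) mh).
  + by move=> s; exact: sqr_ge0.
  + by rewrite ler_sqr ?nnegrE ?norm2_ge0// bias1_le.
Qed.

Let curv_moment k : (k <= K)%N ->
  exists2 s, has_mean P (fun t => norm2 (curv k t (xi k t)) ^+ 2) s & s <= cB ^+ 2.
Proof.
move=> kK.
have mh := measurable_sqr_norm2 (curv_mid kK).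
apply: (@freshD k (fun t z => norm2 (curv k t z) ^+ 2) (cst (cB ^+ 2))).
- exact: mh.
- by move=> t s; exact: sqr_ge0.
- exact: has_mean_cst.
- move=> t; have := hess_variance A1 (x k t + b k t *: step k t) (step k t).
  rewrite unlock => /le_trans -> //; rewrite lee_fin -exprMn.
  rewrite ler_sqr; [|by rewrite nnegrE mulr_ge0 ?norm2_ge0|exact: cB_ge0].
  by rewrite /cB -mulrA ler_wpM2l// norm2_step.
Qed.

Let grad_noise_moment k : (k <= K)%N ->
  exists2 s, has_mean P (fun t => norm2 (grad_noise k t (xi k t)) ^+ 2) s &
    s <= sigma_g ^+ 2.
Proof.
move=> kK.
have mh := measurable_sqr_norm2 (grad_noise_mid kK).
apply: (@freshD k (fun t z => norm2 (grad_noise k t z) ^+ 2) (cst (sigma_g ^+ 2))).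
- exact: mh.
- by move=> t s; exact: sqr_ge0.
- exact: has_mean_cst.
- by move=> t; have := grad_variance A1 (x k t + step k t); rewrite unlock.
Qed.

Let has_mean_dot_exists (X Y : T -> borel_rV R d) (r s : R) :
  measurable_fun setT (fun t => dot (X t) (Y t)) ->
  has_mean P (fun t => norm2 (X t) ^+ 2) r ->
  has_mean P (fun t => norm2 (Y t) ^+ 2) s ->
  exists q, has_mean P (fun t => dot (X t) (Y t)) q.
Proof.
move=> mXY hX hY; apply: (has_mean_dominated mXY _ (has_meanD hX hY)) => t.
exact: dot_abs_le_sqr.
Qed.

Let bias1_meas_T k : (k <= K)%N -> measurable_fun setT
  (fun t => w k t *: bias k t (b k t) : borel_rV R d).
Proof.
move=> kK; apply: (@bias1_meas _ T id) => //.
- exact: x_meas (leqW kK).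
- exact: m_meas (leqW kK).
Qed.

Let curv_meas_T k : (k <= K)%N -> measurable_fun setT
  (fun t => curv k t (xi k t) : borel_rV R d).
Proof.
move=> kK; apply: (@curv_meas _ T id) => //.
- exact: x_meas (leqW kK).
- exact: m_meas (leqW kK).
Qed.

Let grad_noise_meas_T k : (k <= K)%N -> measurable_fun setT
  (fun t => grad_noise k t (xi k t) : borel_rV R d).
Proof.
move=> kK; apply: (@grad_noise_meas _ T id) => //.
- exact: x_meas (leqW kK).
- exact: m_meas (leqW kK).
Qed.

(** [w k] and [Mart k] belong to the past, so for fixed [t] the integral is that of
    [integral_hess_line] in the direction [w k t *: Mart k t]. The second moment of [Mart k] makes
    the product integrable, which is why orthogonality and [Mart_moment] advance together. *)
Let bias_orthogonal k r : (k <= K)%N -> has_mean P (fun t => norm2 (Mart k t) ^+ 2) r ->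
  has_mean P (fun t => dot (Mart k t) (w k t *: bias k t (b k t))) 0.
Proof.
move=> kK hM; have [s hs _] := bias1_moment kK.
have mM := on_before (V := measurableTypeR R) (Mart_adapted (leqW kK)).
have mh := measurable_dot mM (bias1_before kK).
apply: (@freshU0 k (fun t s => dot (Mart k t) (w k t *: bias k t s))).
- exact: mh.
- apply: (has_mean_dot_exists _ hM hs).
  by apply: measurable_dot; [exact: Mart_meas (leqW kK)|exact: bias1_meas_T].
- move=> t; rewrite integral_uniform01; last first.
    by apply/measurable_EFinP; exact: (slice_meas (t : before k) mh).
  have := integral_hess_line N_norm theta_lo_gt0 theta_loP rho_hiP f_diff L0_ge0 L1_gt0 A3
    (x k t) (step k t) (w k t *: Mart k t).
  move=> <-; apply: eq_integral => u _; congr EFin.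
  by rewrite [LHS]dotZr dotZr dotC.
Qed.

Let curv_orthogonal k r : (k <= K)%N -> has_mean P (fun t => norm2 (Mart k t) ^+ 2) r ->
  has_mean P (fun t => dot (Mart k t) (curv k t (xi k t))) 0.
Proof.
move=> kK hM; have [s hs _] := curv_moment kK.
have mM := on_mid (V := Z) (measurable_sub_spaceS (@past_mid k) (Mart_adapted (leqW kK))).
have mh := measurable_dot mM (curv_mid kK).
apply: (@freshD0 k (fun t z => dot (Mart k t) (curv k t z))).
- exact: mh.
- apply: (has_mean_dot_exists _ hM hs).
  by apply: measurable_dot; [exact: Mart_meas (leqW kK)|exact: curv_meas_T].
- move=> t; apply: integral_has_mean.
  (* As [b k] belongs to [mid k], the point [y] is fixed while [z] is integrated, and unbiasedness
     can be applied entry by entry. *)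
  rewrite /curv; set y := x k t + _; set v := step k t; set M := Mart k t.
  have entryB (A B : 'M[R]_d) i j : (A - B) i j = A i j - B i j by rewrite !mxE.
  have entry z : dot M (v *m (hess (F z) y - hess f y)) =
      \sum_(j < d) M ord0 j * \sum_(i < d)
        v ord0 i * (hess (F z) y i j - hess f y i j).
    apply: eq_bigr => j _; rewrite [in LHS]mxE; congr (_ * _).
    by apply: eq_bigr => i _; rewrite entryB.
  under eq_fun do rewrite entry.
  have h0 i j : has_mean D (fun z => v ord0 i * (hess (F z) y i j - hess f y i j)) 0.
    exact: has_mean_centered (hess_unbiased A1 y i j).
  have h1 j : has_mean D (fun z => M ord0 j * \sum_(i < d)
        v ord0 i * (hess (F z) y i j - hess f y i j)) 0.
    have := has_meanZ (M ord0 j) (has_mean_sum (index_enum 'I_d) (h0 ^~ j)).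
    by rewrite big1// mulr0.
  by have := has_mean_sum (index_enum 'I_d) h1; rewrite big1.
Qed.

Let grad_noise_orthogonal k r : (k <= K)%N ->
  has_mean P (fun t => norm2 (Mart k t) ^+ 2) r ->
  has_mean P (fun t => dot (Mart k t) (grad_noise k t (xi k t))) 0.
Proof.
move=> kK hM; have [s hs _] := grad_noise_moment kK.
have mM := on_mid (V := Z) (measurable_sub_spaceS (@past_mid k) (Mart_adapted (leqW kK))).
have mh := measurable_dot mM (grad_noise_mid kK).
apply: (@freshD0 k (fun t z => dot (Mart k t) (grad_noise k t z))).
- exact: mh.
- apply: (has_mean_dot_exists _ hM hs).
  by apply: measurable_dot; [exact: Mart_meas (leqW kK)|exact: grad_noise_meas_T].
- move=> t; apply: integral_has_mean.
  rewrite /grad_noise; set y := x k t + _; set M := Mart k t.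
  have entry z : dot M (grad (F z) y - grad f y) =
      \sum_(j < d) M ord0 j * (grad (F z) y ord0 j - grad f y ord0 j).
    have e (p q : 'rV[R]_d) j : (p - q) ord0 j = p ord0 j - q ord0 j by rewrite !mxE.
    by apply: eq_bigr => j _; rewrite e.
  under eq_fun do rewrite entry.
  have h1 j : has_mean D (fun z =>
      M ord0 j * (grad (F z) y ord0 j - grad f y ord0 j)) 0.
    exact: has_mean_centered (grad_unbiased A1 y j).
  by have := has_mean_sum (index_enum 'I_d) h1; rewrite big1.
Qed.

(** The invariant [alpha * a <= c] survives a step because [beta ^+ 2 <= beta = 1 - alpha]: the new
    value is at most [beta * c + alpha * c = c]. *)
Let Mart_moment k : (k <= K.+1)%N ->
  exists2 a, has_mean P (fun t => norm2 (Mart k t) ^+ 2) a &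
    alpha * a <= 3 * (cA ^+ 2 + cB ^+ 2 + alpha ^+ 2 * sigma_g ^+ 2).
Proof.
set c := 3 * _.
have c_ge0 : 0 <= c.
  apply: mulr_ge0 => //; apply: addr_ge0; first by apply: addr_ge0; exact: sqr_ge0.
  by apply: mulr_ge0; exact: sqr_ge0.
elim: k => [_|k ih kK].
  exists 0; last by rewrite mulr0.
  rewrite (_ : (fun _ => _) = cst 0); first exact: has_mean_cst.
  by apply/funext => t /=; rewrite -(scale0r (0 : 'rV[R]_d)) norm2Z normr0 mul0r expr0n.
have [a hM aP] := ih (ltnW kK).
have [s1 h1 s1P] := bias1_moment kK.
have [s2 h2 s2P] := curv_moment kK.
have [s3 h3 s3P] := grad_noise_moment kK.
have [a' ha' a'P] := second_moment_step alpha beta01 (Mart_meas (ltnW kK)) (bias1_meas_T kK)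
  (curv_meas_T kK) (grad_noise_meas_T kK) hM h1 h2 h3 (bias_orthogonal kK hM)
  (curv_orthogonal kK hM) (grad_noise_orthogonal kK hM).
exists a'; first exact: ha'.
have a_ge0 : 0 <= a by apply: has_mean_ge0 hM _ => t; exact: sqr_ge0.
have a's : a' <= beta ^+ 2 * a + c.
  rewrite (le_trans a'P)// lerD2l /c ler_wpM2l//.
  by rewrite lerD ?lerD// ler_wpM2l ?sqr_ge0.
have /andP[b0 b1] := beta01.
have b2 : beta ^+ 2 <= beta by rewrite expr2 ler_piMl.
rewrite (le_trans (ler_wpM2l (ltW alpha_gt0) a's))// mulrDr mulrCA.
rewrite (@le_trans _ _ (beta * c + alpha * c))//; last by rewrite -mulrDl subrK mul1r.
rewrite lerD2r (le_trans (ler_wpM2l (sqr_ge0 _) aP))//.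
by rewrite ler_wpM2r.
Qed.

(** * Mean gradient norms and the remainder *)

Let g_bounded k : (k <= K.+1)%N -> exists G, forall t, g (x k t) <= G.
Proof.
elim: k => [_|k ih kK]; first by exists (g x0) => t; rewrite x_init.
(* The bound may grow with [k]; it only serves to make the mean of the gradient norm exist. *)
have [G GP] := ih (ltnW kK); exists (c1 * (L0 + L1 * G) * eta + G) => t.
rewrite xS// -[grad f (_ + _)](subrK (grad f (x k t))) (le_trans (dnD _ _))// lerD//.
have := grad_step N_norm theta_lo_gt0 theta_loP rho_hiP f_diff L0_ge0 L1_gt0 A3
  (x k t) (step_small t kK).
move=> /le_trans -> //; rewrite -mulrA -[leRHS]mulrA ler_wpM2l//.
apply: ler_pM; [exact: slope_ge0|exact: is_norm_ge0| |exact: N_step].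
by rewrite lerD2l ler_wpM2l.
Qed.

Let gam k : R := fine ('E_P[fun t => g (x k t)])%E.

Let gamP k : (k <= K.+1)%N -> has_mean P (fun t => g (x k t)) (gam k).
Proof.
move=> kK; have [G GP] := g_bounded kK.
have [||r hr] := has_mean_dominated _ _ (has_mean_cst P G) (X := fun t => g (x k t)).
- by apply: dn_meas; apply: grad_meas; exact: x_meas.
- by move=> t; rewrite ger0_norm.
by have [ig e] := hr; rewrite /gam e.
Qed.

Let gam_ge0 k : (k <= K.+1)%N -> 0 <= gam k.
Proof. by move=> kK; apply: has_mean_ge0 (gamP kK) _ => t; exact: g_ge0. Qed.

Let drift : R := 4 * c1 * L1 * eta.
Let drift_ge0 : 0 <= drift. Proof. by rewrite !mulr_ge0. Qed.

Let bias2_mean k : (k <= K)%N ->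
  exists2 s, has_mean P (fun t => dn ((1 - w k t) *: bias k t (b k t))) s &
    s <= drift * gam k.
Proof.
move=> kK; have mh := dn_meas (bias2_before kK).
apply: (@freshU k (fun t s => dn ((1 - w k t) *: bias k t s))
  (fun t => drift * g (x k t))).
- exact: mh.
- by move=> t s; exact: dn_ge0.
- exact: has_meanZ (gamP (leqW kK)).
- move=> t; apply: integral_uniform01_le => [||s s01].
  + exact: (slice_meas (t : before k) mh).
  + by move=> s; exact: dn_ge0.
  + exact: bias2_le.
Qed.

Section bound.
Context (E0 s finf : R).
Hypothesis e0P : has_mean P (fun t => dn (m0 t - grad f x0)) E0.
Hypothesis s_ge0 : 0 <= s.
Hypothesis sP : 3 * (cA ^+ 2 + cB ^+ 2 + alpha ^+ 2 * sigma_g ^+ 2) <= alpha * s ^+ 2.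
Hypothesis f_lb : forall y, finf <= f y.

Let rest_bound : nat -> R := fix rest_bound k := match k with
  | 0%N => E0 | k.+1 => beta * (rest_bound k + drift * gam k)
  end.

Let Rest_meas k : (k <= K.+1)%N -> measurable_fun setT (Rest k : T -> borel_rV R d).
Proof.
move=> kK; apply: measurable_rVB; last exact: Mart_meas.
by apply: measurable_rVB; [exact: m_meas|apply: grad_meas; exact: x_meas].
Qed.

Let Rest_mean k : (k <= K.+1)%N ->
  exists2 q, has_mean P (fun t => dn (Rest k t)) q & q <= rest_bound k.
Proof.
have /andP[b0 b1] := beta01.
elim: k => [_|k ih kK].
  exists E0 => //; rewrite (_ : (fun _ => _) = (fun t => dn (m0 t - grad f x0)))//.
  by apply/funext => t; rewrite /Rest /err m_init x_init /= subr0.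
have [q hq qP] := ih (ltnW kK); have [r hr rP] := bias2_mean kK.
have hb := has_meanZ beta (has_meanD hq hr).
have Rle t : dn (Rest k.+1 t) <=
    beta * (dn (Rest k t) + dn ((1 - w k t) *: bias k t (b k t))).
  by rewrite RestS// (le_trans (dnZ _ _))// ger0_norm// ler_wpM2l.
have mR : measurable_fun setT (fun t => dn (Rest k.+1 t)).
  by apply: dn_meas; exact: Rest_meas.
have Rb t : `|dn (Rest k.+1 t)| <=
    beta * (dn (Rest k t) + dn ((1 - w k t) *: bias k t (b k t))).
  by rewrite ger0_norm.
have [q' hq'] := has_mean_dominated mR Rb hb.
exists q' => //; rewrite (le_trans (has_mean_mono hq' hb Rle))//.
by rewrite /= ler_wpM2l// lerD.
Qed.

Let rest_bound_ge0 k : (k <= K.+1)%N -> 0 <= rest_bound k.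
Proof.
move=> kK; have [q hq qP] := Rest_mean kK.
by rewrite (le_trans _ qP)//; apply: has_mean_ge0 hq _ => t; exact: dn_ge0.
Qed.

(** Sums [alpha r_k = r_k - r_(k+1) + (1 - alpha) drift gam_k], which telescopes; the geometric
    weights are never unfolded. *)
Let rest_bound_sum n : (n <= K.+1)%N ->
  alpha * (\sum_(k < n) rest_bound k) + rest_bound n <=
  E0 + drift * (\sum_(k < n) gam k).
Proof.
elim: n => [_|n ih nK]; first by rewrite !big_ord0 !mulr0 add0r addr0.
have := ih (ltnW nK); rewrite !big_ord_recr/= /beta.
have h : 0 <= alpha * (drift * gam n).
  by rewrite !mulr_ge0 ?gam_ge0 ?(ltW alpha_gt0)// ltnW.
move: (\sum_(k < n) _) (\sum_(k < n) _) (rest_bound n) h => S1 S2 r h; lra.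
Qed.

(** The martingale returns to the dual norm here, at the price [rho_hi]; through [sP], [s] bounds
    the root of its second moment. *)
Let err_mean k : (k <= K)%N ->
  exists q, has_mean P (fun t => dn (err k t)) q /\ q <= rest_bound k + rho_hi * s.
Proof.
move=> kK; have [q hq qP] := Rest_mean (leqW kK).
have [a ha aP] := Mart_moment (leqW kK).
have [|r hr rP] := has_mean_norm2 (Mart_meas (leqW kK)) s_ge0 _ ha.
  by rewrite -(ler_pM2l alpha_gt0) (le_trans aP).
have hb := has_meanD hq (has_meanZ rho_hi hr).
have ele t : dn (err k t) <= dn (Rest k t) + rho_hi * norm2 (Mart k t).
  rewrite -[err k t](subrK (Mart k t)) (le_trans (dnD _ _))// lerD2l.
  exact: rho_hiP.
have me : measurable_fun setT (fun t => dn (err k t)).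
  apply: dn_meas; apply: measurable_rVB; first exact: m_meas (leqW kK).
  by apply: grad_meas; exact: x_meas (leqW kK).
have eb t : `|dn (err k t)| <= dn (Rest k t) + rho_hi * norm2 (Mart k t).
  by rewrite ger0_norm.
have [e he] := has_mean_dominated me eb hb.
exists e; split=> //; rewrite (le_trans (has_mean_mono he hb ele))//.
by rewrite lerD// ler_wpM2l// ltW.
Qed.

(** * Descent and summation over the iterations *)

Let descent_step k t : (k <= K)%N ->
  f (x k.+1 t) <= f (x k t) - eta * g (x k t) + 2 * eta * dn (err k t)
    + c1 * eta ^+ 2 * (L0 + L1 * g (x k t)).
Proof.
move=> kK; rewrite xS//.
have h1 := descent N_norm theta_lo_gt0 theta_loP rho_hiP f_diff L0_ge0 L1_gt0 A3
  (x k t) (step_small t kK).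
have h2 := dual_norm_lmo N_norm theta_lo_gt0 theta_loP eta_ge0 (lmoP (m k t) kK).
have h3 := dot_le_dual N_norm theta_lo_gt0 theta_loP (- err k t) (step k t).
have h4 : dot (grad f (x k t)) (step k t) = dot (m k t) (step k t) + dot (- err k t) (step k t).
  by rewrite -dotDl /err opprB subrKC.
(* The error enters twice, in the inner product with the step ([h3]) and in the comparison of the
   dual norms of [m k] and the gradient, hence [2 * eta]. *)
have h5 : g (x k t) <= dn (m k t) + dn (err k t).
  rewrite (_ : grad f (x k t) = m k t + (- err k t)); last by rewrite /err opprB subrKC.
  by rewrite (le_trans (dnD _ _))// dnN.
have h6 : dn (- err k t) * N (step k t) <= dn (err k t) * eta.
  by rewrite dnN ler_wpM2l// N_step.
have h7 : 80 / 79 * (L0 + L1 * g (x k t)) * N (step k t) ^+ 2 <=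
    c1 * eta ^+ 2 * (L0 + L1 * g (x k t)).
  rewrite [leRHS]mulrAC ler_wpM2l ?mulr_ge0//.
  by rewrite ler_sqr ?nnegrE ?N_step// is_norm_ge0.
have h8 := ler_wpM2l eta_ge0 h5; rewrite mulrDr in h8.
rewrite -/(step k t) in h2.
move: h1 h2 h3 h6 h7 h8; rewrite h4.
move: (dot (m k t) _) (dot (- err k t) _) (dn (- err k t) * _) (eta * dn (m k t)).
move: (_ * N _ ^+ 2) (c1 * _ * _) (eta * g _) (f _) (f _) (dn (err k t)).
move=> z1 z2 z3 z4 z5 z6 z7 z8 z9 z10; lra.
Qed.

Let descent_sum t n : (n <= K.+1)%N ->
  \sum_(k < n) eta * g (x k t) <= f x0 - f (x n t)
   + \sum_(k < n) (2 * eta * dn (err k t) + c1 * eta ^+ 2 * (L0 + L1 * g (x k t))).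
Proof.
elim: n => [_|n ih nK]; first by rewrite !big_ord0 x_init subrr addr0.
have := ih (ltnW nK); have := descent_step t nK; rewrite !big_ord_recr/=.
move: (\sum_(k < n) _) (\sum_(k < n) _) => S1 S2.
move: (f _) (f _) (eta * g _) (2 * eta * _) (c1 * _ * _) (f _) => z1 z2 z3 z4 z5 z6.
lra.
Qed.

Let mean_sum_bound :
  eta * (\sum_(k < K.+1) gam k) <= f x0 - finf
    + 2 * eta * ((E0 + drift * \sum_(k < K.+1) gam k) / alpha + K.+1%:R * (rho_hi * s))
    + c1 * eta ^+ 2 * (K.+1%:R * L0 + L1 * \sum_(k < K.+1) gam k).
Proof.
have [eps epsP] := choice (fun i : 'I_K.+1 => err_mean (ltn_ord i)).
have h1 := has_mean_sum (index_enum 'I_K.+1)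
  (fun i : 'I_K.+1 => has_meanZ eta (gamP (leqW (ltn_ord i)))).
have h2 := has_meanD (has_mean_cst P (f x0 - finf)) (has_mean_sum (index_enum 'I_K.+1)
  (fun i : 'I_K.+1 => has_meanD (has_meanZ (2 * eta) (epsP i).1)
    (has_meanZ (c1 * eta ^+ 2) (has_meanD (has_mean_cst P L0)
       (has_meanZ L1 (gamP (leqW (ltn_ord i)))))))).
have := has_mean_mono h1 h2; rewrite -mulr_sumr => /(_ _)/le_trans; apply.
  move=> t; have := descent_sum t (leqnn K.+1); rewrite /cst => /le_trans -> //.
  by rewrite lerD2r lerD2l lerN2.
rewrite -[leRHS]addrA lerD2l big_split/= -!mulr_sumr; apply: lerD.
  rewrite ler_wpM2l ?mulr_ge0//.
  rewrite (@le_trans _ _ (\sum_(i < K.+1) (rest_bound i + rho_hi * s)))//.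
    by apply: ler_sum => i _; exact: (epsP i).2.
  rewrite big_split/= sumr_const card_ord -[in leLHS]mulr_natl lerD2r.
  rewrite ler_pdivlMr// mulrC.
  (* The last term [rest_bound K.+1] is nonnegative and is dropped. *)
  have := rest_bound_sum (leqnn K.+1); have := rest_bound_ge0 (leqnn K.+1).
  move: (\sum_(k < K.+1) _) (\sum_(k < K.+1) _) (rest_bound _) => z1 z2 z3; lra.
by rewrite big_split/= sumr_const card_ord -[in leLHS]mulr_natl -mulr_sumr.
Qed.

Lemma gradient_sum_bound : exists gam : nat -> R,
  (forall k, (k <= K)%N -> has_mean P (fun t => g (x k t)) (gam k)) /\
  eta * (\sum_(k < K.+1) gam k) <= f x0 - finf
    + 2 * eta * ((E0 + 4 * (80 / 79) * L1 * eta * \sum_(k < K.+1) gam k) / alpha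
                 + K.+1%:R * (rho_hi * s))
    + 80 / 79 * eta ^+ 2 * (K.+1%:R * L0 + L1 * \sum_(k < K.+1) gam k).
Proof. by exists gam; split; [move=> k kK; exact: gamP (leqW kK)|exact: mean_sum_bound]. Qed.

End bound.
End algorithm.

(** * The rate *)

(** The terms in [S] on the right amount to at most [8/79 + 1/79] of the left side, so 70/79 of it
    remains. The tight constant is that of [sigma_g]: [7/2 * 79/70 = 3.95], just below 4. *)
Lemma rate_bound {R : realType} (p eta_hat L0 L1 rho_lo rho_hi theta_lo sigma_g sigma_H
    Delta E0 s S ex sq : R) (n : R) :
  1 <= p -> n = p ^+ 3 -> 0 < L1 -> 0 <= L0 -> 0 < rho_lo -> rho_lo <= rho_hi ->
  0 < theta_lo -> 0 <= sigma_g -> 0 <= sigma_H -> 0 <= Delta -> 0 <= E0 -> 0 <= S ->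
  eta_hat = 1 / (80 * L1) * (rho_hi / rho_lo)^-1 -> 1 <= ex -> 0 <= sq ->
  let eta := eta_hat / p ^+ 2 in
  s = 7 / 4 * p * (4 * (80 / 79) * L0 * eta / rho_lo + sigma_H * eta / theta_lo
                   + 1 / p ^+ 2 * sigma_g) ->
  eta * S <= Delta
    + 2 * eta * ((E0 + 4 * (80 / 79) * L1 * eta * S) / (1 / p ^+ 2) + n * (rho_hi * s))
    + 80 / 79 * eta ^+ 2 * (n * L0 + L1 * S) ->
  S / n <= 2 * Delta / (eta_hat * p) + 4 * (E0 + rho_hi * sigma_g) / p
    + eta_hat * L0 * ex / p ^+ 2
    + 12 * (rho_hi / rho_lo) * (eta_hat * L0 / p) * (ex + sq * ex + 2)
    + 8 * (rho_hi / theta_lo) * (eta_hat * sigma_H / p).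
Proof.
move=> p1 -> L1_gt0 L0_ge0 rlo rlohi tlo sg sH D0 E00 S0 etaE ex1 sq0 eta sE.
have p0 : 0 < p by rewrite (lt_le_trans _ p1).
have rhi : 0 < rho_hi by rewrite (lt_le_trans rlo).
have eh0 : 0 < eta_hat.
  by rewrite etaE mulr_gt0// ?invr_gt0 ?divr_gt0// mulr_gt0.
have qE : L1 * eta_hat = 80^-1 * (rho_lo / rho_hi).
  by rewrite etaE; field; rewrite !gt_eqF.
have q0 : 0 <= L1 * eta_hat by rewrite mulr_ge0 ?ltW.
have q1 : L1 * eta_hat <= 80^-1.
  by rewrite qE ler_piMr// ler_pdivrMr// mul1r.
have [p0' eh0' rlo' rhi' tlo'] := And5 (ltW p0) (ltW eh0) (ltW rlo) (ltW rhi) (ltW tlo).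
rewrite sE /eta => h.
pose Gam := S / p ^+ 3.
have Gam0 : 0 <= Gam by apply: divr_ge0 => //; exact: exprn_ge0.
have SE : S = p ^+ 3 * Gam by rewrite /Gam; field; rewrite gt_eqF.
pose a1 := rho_hi / rho_lo * (eta_hat * L0 / p).
pose a2 := rho_hi / theta_lo * (eta_hat * sigma_H / p).
pose a3 := rho_hi * sigma_g / p.
pose a4 := eta_hat * L0 / p ^+ 2.
pose D1 := Delta / (eta_hat * p).
pose e1 := E0 / p.
have p30 : 0 <= p^-1 by rewrite invr_ge0.
have a10 : 0 <= a1.
  by apply: mulr_ge0; [exact: divr_ge0|apply: mulr_ge0 => //; exact: mulr_ge0].
have a20 : 0 <= a2.
  by apply: mulr_ge0; [exact: divr_ge0|apply: mulr_ge0 => //; exact: mulr_ge0].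
have a30 : 0 <= a3 by apply: mulr_ge0 => //; exact: mulr_ge0.
have a40 : 0 <= a4 by apply: divr_ge0; [exact: mulr_ge0|exact: exprn_ge0].
have D10 : 0 <= D1 by apply: divr_ge0 => //; exact: mulr_ge0.
have e10 : 0 <= e1 by exact: divr_ge0.
(* The hypothesis divided by [eta * p ^+ 3 = eta_hat * p]. *)
have hG : Gam <= D1 + 2 * e1 + 8 * (80 / 79) * (L1 * eta_hat * Gam)
    + 7 / 2 * (4 * (80 / 79) * a1 + a2 + a3) + 80 / 79 * a4
    + 80 / 79 * (L1 * eta_hat * Gam / p ^+ 2).
  have ep : 0 < eta_hat * p by rewrite mulr_gt0.
  rewrite -(ler_pM2l ep); move: h; rewrite SE.
  set l1 := (X in X <= _ -> _); set r1 := (X in _ <= X -> _).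
  set l2 := (X in _ -> X <= _); set r2 := (X in _ -> _ <= X).
  suff [-> ->] : l2 = l1 /\ r2 = r1 by [].
  rewrite /l1 /l2 /r1 /r2 /a1 /a2 /a3 /a4 /D1 /e1; split; field; rewrite ?gt_eqF//.
have y1 : L1 * eta_hat * Gam <= 80^-1 * Gam by rewrite ler_wpM2r.
have y2 : L1 * eta_hat * Gam / p ^+ 2 <= L1 * eta_hat * Gam.
  by rewrite ler_piMr ?(mulr_ge0 q0 Gam0)// invf_le1 ?exprn_gt0// exprn_ege1.
have t1 : a4 <= a4 * ex by rewrite ler_peMr.
have t2 : a1 * 3 <= a1 * (ex + sq * ex + 2).
  by rewrite ler_wpM2l// -[3]/(1 + 2) lerD2r ler_wpDr// mulr_ge0// (le_trans ler01).
(* After absorption the coefficient of [a4] is 8/7, while [ex] is only known to be at least 1; the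
   excess 1/7 is charged to [a1], whose coefficient 16 is well below 36. *)
have t3 : a4 <= a1.
  have b0 : 0 <= eta_hat * L0 / p by apply: mulr_ge0 => //; exact: mulr_ge0.
  have -> : a4 = eta_hat * L0 / p * p^-1 by rewrite /a4; field; rewrite gt_eqF.
  rewrite (@le_trans _ _ (eta_hat * L0 / p))//; first by rewrite ler_piMr// invf_le1.
  by rewrite /a1 ler_peMl// ler_pdivlMr// mul1r.
rewrite -/Gam.
have -> : 2 * Delta / (eta_hat * p) = 2 * D1 by rewrite /D1 mulrA.
have -> : 4 * (E0 + rho_hi * sigma_g) / p = 4 * e1 + 4 * a3.
  by rewrite /e1 /a3; field; rewrite gt_eqF.
have -> : eta_hat * L0 * ex / p ^+ 2 = a4 * ex by rewrite /a4 mulrAC.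
have -> : 12 * (rho_hi / rho_lo) * (eta_hat * L0 / p) * (ex + sq * ex + 2) =
  12 * (a1 * (ex + sq * ex + 2)) by rewrite /a1 !mulrA.
have -> : 8 * (rho_hi / theta_lo) * (eta_hat * sigma_H / p) = 8 * a2.
  by rewrite /a2 !mulrA.
move: hG y1 y2 t1 t2 t3; move: (L1 * eta_hat * Gam) (_ / p ^+ 2) (a4 * ex) (a1 * (_ + _ + 2)).
move=> z1 z2 z3 z4; lra.
Qed.

(** [7 / 4] is a rational just above the square root of 3; replacing the sum of squares by the
    square of the sum makes an explicit root [s] available. *)
Lemma sum_sqr3_le {R : realType} (a b c : R) : 0 <= a -> 0 <= b -> 0 <= c ->
  3 * (a ^+ 2 + b ^+ 2 + c ^+ 2) <= 49 / 16 * (a + b + c) ^+ 2.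
Proof.
move=> a0 b0 c0.
have -> : (a + b + c) ^+ 2 =
  a ^+ 2 + b ^+ 2 + c ^+ 2 + 2 * (a * b) + 2 * (a * c) + 2 * (b * c) by ring.
have := mulr_ge0 a0 b0; have := mulr_ge0 a0 c0; have := mulr_ge0 b0 c0.
have := sqr_ge0 a; have := sqr_ge0 b; have := sqr_ge0 c; lra.
Qed.

Lemma exists_le_average {R : realType} n (a : nat -> R) :
  exists2 k, (k <= n)%N & a k <= (\sum_(i < n.+1) a i) / n.+1%:R.
Proof.
apply: contrapT => h.
have lt k : (k <= n)%N -> (\sum_(i < n.+1) a i) / n.+1%:R < a k.
  by move=> kn; rewrite ltNge; apply/negP => ak; apply: h; exists k.
have : \sum_(i < n.+1) (\sum_(i < n.+1) a i) / n.+1%:R < \sum_(i < n.+1) a i.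
  rewrite [ltLHS]big_ord_recl [ltRHS]big_ord_recl; apply: ltr_leD; first exact: lt.
  by apply: ler_sum => i _; apply/ltW/lt; exact: ltn_ord.
by rewrite sumr_const card_ord -[ltLHS]mulr_natr divfK ?pnatr_eq0// ltxx.
Qed.

(* xi k and b k stand for the (k+1)-st sample and the (k+1)-st uniform
   variable of the informal statement, xhat k.+1 for the (k+1)-st
   intermediate point. *)
Theorem theorem1 (R : realType) (d : nat)
  (dT dZ : measure_display) (T : measurableType dT) (Z : measurableType dZ)
  (P : probability T R) (D : probability Z R)
  (* the norm and the equivalence constants *)
  (N : 'rV[R]_d -> R) (N_norm : is_norm N)
  (rho_lo rho_hi theta_lo theta_hi : R)
  (rho_lo_gt0 : 0 < rho_lo) (rho_hi_gt0 : 0 < rho_hi)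
  (theta_lo_gt0 : 0 < theta_lo) (theta_hi_gt0 : 0 < theta_hi)
  (rhoP : forall x : 'rV[R]_d,
    rho_lo * norm2 x <= dual_norm N x <= rho_hi * norm2 x)
  (thetaP : forall x : 'rV[R]_d,
    theta_lo * norm2 x <= N x <= theta_hi * norm2 x)
  (* the objective *)
  (F : Z -> 'rV[R]_d -> R) (f : 'rV[R]_d -> R)
  (F_diff : forall z, twice_differentiable (F z))
  (f_diff : twice_differentiable f)
  (f_mean : forall x, has_mean D (F^~ x) (f x))
  (* the assumptions (A1), (A2), (A3) *)
  (sigma_g sigma_H L0 L1 : R)
  (sigma_g_ge0 : 0 <= sigma_g) (sigma_H_ge0 : 0 <= sigma_H)
  (L0_ge0 : 0 <= L0) (L1_gt0 : 0 < L1)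
  (A1 : stochastic_gradient_hessian D F f sigma_g sigma_H)
  (A2 : has_lbound (range f))
  (A3 : symmetric_L0L1_lipschitz N L0 L1 f)
  (* the parameters *)
  (K : nat) (K_ge1 : (1 <= K)%N)
  (alpha eta eta_hat : R)
  (alphaE : alpha = 1 / K.+1%:R `^ (2 / 3))
  (etaE : eta = eta_hat / K.+1%:R `^ (2 / 3))
  (eta_hatE : eta_hat = 1 / (80 * L1) * (rho_hi / rho_lo)^-1)
  (* the sources of randomness *)
  (xi : nat -> {RV P >-> Z}) (b : nat -> {RV P >-> R})
  (x0 : 'rV[R]_d) (m0 : T -> 'rV[R]_d)
  (m0_meas : measurable_fun setT (m0 : T -> borel_rV R d))
  (xi_law : forall k, has_law (xi k) D)
  (b_law : forall k, has_law (b k) (uniform_prob (@ltr01 R)))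
  (indep : mutually_independent P (source_sigma_algebra m0 xi b))
  (* the algorithm *)
  (lmo : nat -> 'rV[R]_d -> 'rV[R]_d)
  (lmo_meas : forall k, (k <= K)%N ->
    measurable_fun setT (lmo k : borel_rV R d -> borel_rV R d))
  (lmoP : forall k u, (k <= K)%N -> is_lmo N eta u (lmo k u))
  (x xhat m : nat -> T -> 'rV[R]_d)
  (x_init : forall t, x 0%N t = x0)
  (m_init : forall t, m 0%N t = m0 t)
  (x_step : forall k t, (k <= K)%N -> x k.+1 t = x k t + lmo k (m k t))
  (xhat_step : forall k t, (k <= K)%N ->
    xhat k.+1 t = b k t *: x k.+1 t + (1 - b k t) *: x k t)
  (m_step : forall k t, (k <= K)%N ->
    m k.+1 t =
      (1 - alpha) *:
        (m k t + (x k.+1 t - x k t) *m hess (F (xi k t)) (xhat k.+1 t))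
      + alpha *: grad (F (xi k t)) (x k.+1 t)) :
  (\big[mine/+oo]_(k < K.+1) 'E_P[fun t => dual_norm N (grad f (x k t))] <=
     (2 * (f x0 - inf (range f)) / (eta_hat * K.+1%:R `^ (3^-1)))%:E
   + 4%:E * ('E_P[fun t => dual_norm N (m0 t - grad f x0)]
             + (rho_hi * sigma_g)%:E) * ((K.+1%:R `^ (3^-1))^-1)%:E
   + (eta_hat * L0 * expR (L1 * eta_hat) / K.+1%:R `^ (2 / 3))%:E
   + (12 * (rho_hi / rho_lo) * (eta_hat * L0 / K.+1%:R `^ (3^-1))
        * (expR (L1 * eta_hat)
           + Num.sqrt (L1 * eta_hat) * expR (L1 * eta_hat) + 2))%:E
   + (8 * (rho_hi / theta_lo) * (eta_hat * sigma_H / K.+1%:R `^ (3^-1)))%:E)%E.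
Proof.
have rho_loP u : rho_lo * norm2 u <= dual_norm N u by case/andP: (rhoP u).
have rho_hiP u : dual_norm N u <= rho_hi * norm2 u by case/andP: (rhoP u).
have theta_loP u : theta_lo * norm2 u <= N u by case/andP: (thetaP u).
have dn_ge0 := dual_norm_ge0 N_norm theta_lo_gt0 theta_loP.
(* With the cube root of [K.+1] as the parameter, [alpha] is [1 / p ^+ 2] and all exponents become
   integers. *)
set p := K.+1%:R `^ (3^-1).
have p1 : 1 <= p by rewrite -[1](@powRr0 R K.+1%:R) ler_powR ?ler1n// invr_ge0.
have p0 : 0 < p by rewrite (lt_le_trans _ p1).
have p3 : K.+1%:R = p ^+ 3 :> R.
  by rewrite -powR_mulrn ?(ltW p0)// -powRrM mulVf// powRr1.
have p2 : K.+1%:R `^ (2 / 3) = p ^+ 2.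
  by rewrite -powR_mulrn ?(ltW p0)// -powRrM mulrC.
rewrite p2 in alphaE etaE *.
have eta_hat_gt0 : 0 < eta_hat.
  by rewrite eta_hatE mulr_gt0// ?invr_gt0 ?divr_gt0// mulr_gt0.
have gap_ge0 : 0 <= f x0 - inf (range f).
  by rewrite subr_ge0; apply: ge_inf => //; exists x0.
have [p0' eh0' rlo' rhi' tlo'] :=
  And5 (ltW p0) (ltW eta_hat_gt0) (ltW rho_lo_gt0) (ltW rho_hi_gt0) (ltW theta_lo_gt0).
have eL0_ge0 : 0 <= eta_hat * L0 by exact: mulr_ge0.
set ex := expR (L1 * eta_hat); set sq := Num.sqrt (L1 * eta_hat).
have ex1 : 1 <= ex by rewrite /ex -expR0 ler_expR mulr_ge0// ltW.
have sq0 : 0 <= sq by exact: sqrtr_ge0.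
set t1 := 2 * (f x0 - inf (range f)) / (eta_hat * p).
set t3 := eta_hat * L0 * ex / p ^+ 2.
set t4 := 12 * (rho_hi / rho_lo) * (eta_hat * L0 / p) * (ex + sq * ex + 2).
set t5 := 8 * (rho_hi / theta_lo) * (eta_hat * sigma_H / p).
have t1_ge0 : 0 <= t1 by apply: divr_ge0; exact: mulr_ge0.
have ex0 : 0 <= ex by rewrite (le_trans _ ex1).
have t3_ge0 : 0 <= t3 by apply: divr_ge0; [exact: mulr_ge0|exact: exprn_ge0].
have t4_ge0 : 0 <= t4.
  apply: mulr_ge0; last by rewrite !addr_ge0// mulr_ge0.
  by apply: mulr_ge0; [apply: mulr_ge0 => //; exact: divr_ge0|exact: divr_ge0].
have t5_ge0 : 0 <= t5.
  by apply: mulr_ge0; [apply: mulr_ge0 => //; exact: divr_ge0|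
    apply: divr_ge0 => //; exact: mulr_ge0].
set e0 := 'E_P[fun t => dual_norm N (m0 t - grad f x0)]%E.
have e0_ge0 : (0 <= e0)%E by apply: expectation_ge0 => t; exact: dn_ge0.
have e0E : e0 = (\int[P]_t (dual_norm N (m0 t - grad f x0))%:E)%E.
  by rewrite /e0 unlock.
(* If the initial error has infinite mean, the right-hand side is infinite. *)
have [e0fin|] := boolP (e0 \is a fin_num); last first.
  rewrite ge0_fin_numE// -leNgt leye_eq => /eqP ->.
  rewrite addye// gt0_muley ?lte_fin// gt0_mulye ?lte_fin ?invr_gt0//.
  by rewrite addey// !addye// leey.
have RHSE : (t1%:E + 4%:E * (e0 + (rho_hi * sigma_g)%:E) * p^-1%:E + t3%:E + t4%:E + t5%:E =
    (t1 + 4 * (fine e0 + rho_hi * sigma_g) / p + t3 + t4 + t5)%:E)%E.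
  by rewrite -[in LHS](fineK e0fin).
rewrite RHSE.
have fe0_ge0 : 0 <= fine e0 by exact: fine_ge0.
(* The order of [rho_lo] and [rho_hi] can only fail if [norm2] vanishes identically, that is in
   dimension 0; then every dual norm is zero. *)
have [rlohi|hilo] := leP rho_lo rho_hi; last first.
  have z u : dual_norm N u = 0.
    have n0 : norm2 u <= 0.
      rewrite leNgt; apply/negP => npos.
      by have := le_trans (rho_loP u) (rho_hiP u); rewrite ler_pM2r// leNgt hilo.
    by apply/eqP; rewrite eq_le dn_ge0 andbT (le_trans (rho_hiP u))// mulr_ge0_le0.
  apply: (@bigmin_inf _ _ _ _ ord0) => //.
  rewrite (_ : (fun _ => _) = cst 0) ?expectation_cst; last by apply/funext => t; exact: z.
  by rewrite lee_fin !addr_ge0// divr_ge0// mulr_ge0// addr_ge0// mulr_ge0.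
have alpha_gt0 : 0 < alpha by rewrite alphaE divr_gt0 ?exprn_gt0.
have alpha_le1 : alpha <= 1 by rewrite alphaE div1r invf_le1 ?exprn_gt0// exprn_ege1.
have eta_ge0 : 0 <= eta by rewrite etaE; apply: divr_ge0 => //; exact: exprn_ge0.
have eta_small : L1 * eta <= 80^-1.
  have -> : L1 * eta = 80^-1 * (rho_lo / rho_hi * (p ^+ 2)^-1).
    by rewrite etaE eta_hatE; field; rewrite !gt_eqF.
  rewrite ler_piMr// mulr_ile1 ?divr_ge0 ?invr_ge0 ?exprn_ge0//.
    by rewrite ler_pdivrMr// mul1r.
  by rewrite invf_le1 ?exprn_gt0// exprn_ege1.
pose A := 4 * (80 / 79) * L0 * eta / rho_lo; pose B := sigma_H * eta / theta_lo.
have A_ge0 : 0 <= A by apply: divr_ge0 => //; apply: mulr_ge0 => //; exact: mulr_ge0.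
have B_ge0 : 0 <= B by apply: divr_ge0 => //; exact: mulr_ge0.
(* As [p] is the inverse root of [alpha], [s ^+ 2] is [49 / 16 * (A + B + alpha * sigma_g) ^+ 2 /
   alpha], the bound on the second moment of the martingale. *)
pose s := 7 / 4 * p * (A + B + alpha * sigma_g).
have C_ge0 : 0 <= alpha * sigma_g by rewrite mulr_ge0// ltW.
have s_ge0 : 0 <= s by rewrite mulr_ge0 ?addr_ge0// mulr_ge0.
have sP : 3 * (A ^+ 2 + B ^+ 2 + alpha ^+ 2 * sigma_g ^+ 2) <= alpha * s ^+ 2.
  have -> : alpha * s ^+ 2 = 49 / 16 * (A + B + alpha * sigma_g) ^+ 2.
    rewrite /s; move: (A + B + _) => q; rewrite alphaE; field.
    by rewrite gt_eqF.
  by rewrite -exprMn; exact: sum_sqr3_le.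
have e0_mean : has_mean P (fun t => dual_norm N (m0 t - grad f x0)) (fine e0).
  have m0' : measurable_fun setT (fun t => m0 t - grad f x0 : borel_rV R d).
    by apply: measurable_rVB => //; exact: measurable_cst.
  have me : measurable_fun setT (fun t => dual_norm N (m0 t - grad f x0)).
    apply: (measurableT_comp (f := dual_norm N : borel_rV R d -> R)) => //.
    apply: continuous_measurable_rV.
    exact: (continuous_dual_norm N_norm theta_lo_gt0 theta_loP rho_hiP).
  apply: has_mean_integral; last by rewrite -e0E fineK.
  apply/integrableP; split; first exact/measurable_EFinP.
  under eq_integral do rewrite gee0_abs ?lee_fin//.
  by rewrite -e0E -ge0_fin_numE.
have f_lb y : inf (range f) <= f y by apply: ge_inf => //; exists y.
have [gam [gamP gam_bound]] := gradient_sum_bound N_norm rho_lo_gt0 rho_hi_gt0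
  theta_lo_gt0 rho_loP rho_hiP theta_loP F_diff f_diff sigma_H_ge0 L0_ge0 L1_gt0
  A1 A3 alpha_gt0 alpha_le1 eta_ge0 eta_small m0_meas xi_law b_law indep lmo_meas
  lmoP x_init m_init x_step xhat_step m_step e0_mean s_ge0 sP f_lb.
have S_ge0 : 0 <= \sum_(k < K.+1) gam k.
  apply: sumr_ge0 => k _; have := gamP k (ltn_ord k).
  by move=> /has_mean_ge0; apply => t; exact: dn_ge0.
have [k kK gamk] := exists_le_average K gam.
apply: (@bigmin_inf _ _ _ _ (Ordinal (kK : (k < K.+1)%N))) => //.
rewrite /= (gamP k kK).2 lee_fin (le_trans gamk)//.
apply: (@rate_bound _ p eta_hat L0 L1 rho_lo rho_hi theta_lo sigma_g sigma_H _ _ s) => //.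
  by rewrite /s /A /B alphaE etaE.
by rewrite -etaE -alphaE.
Qed.
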